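(* Let $\{m_n\colon(\Pi V)^{\otimes n}\to\Pi V\}_{n\ge2}$ be an $L_\infty$-algebra structure on a super vector space $V$, and let $(i,p,s)$ be a strong deformation retract of $V$ onto its homology $\mathrm H(V)$. Then there is an induced $L_\infty$-algebra structure $\{l_n\colon(\Pi\mathrm H(V))^{\otimes n}\to\Pi\mathrm H(V)\}_{n\ge2}$ on $\mathrm H(V)$ given, for suitable signs $\pm$, by $$l_n=\sum_{T\in\mathrm{Tree}_n}\pm\, T(i,s,p,\{m_k\}),$$ where $\mathrm{Tree}_n$ is the set of rooted trees with $n$ leaves (labelled by the inputs $1,\dots,n$), and $T(i,s,p,\{m_k\})$ is the composite obtained by labelling the input edges (leaves) of $T$ by $i$, the internal edges by $s$, the output (root) edge by $p$, and each vertex with $k$ inputs by $m_k$. Moreover, the quasi-isomorphism $i$ extends to an $L_\infty$-quasi-isomorphism from $(\mathrm H(V),\{l_n\})$ to $(V,\{m_n\})$, i.e. there is such an $L_\infty$-morphism whose linear component is $i$.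
   Context: Base field $\mathbb R$. A super vector space is a $\mathbb Z/2$-graded vector space with an odd differential $d$; $\Pi$ is parity reversion; $\hat S$ denotes the completed symmetric algebra (duals are pseudo-compact, tensor products of pseudo-compact spaces are completed). $\mathrm H(V)$ has zero differential. An $L_\infty$-algebra structure on $V$ is an odd derivation $m\in\mathrm{Der}_{\ge2}(\hat S\Pi V^* )$ (i.e. sending $\Pi V^*$ into terms of order $\ge2$) with $d(m)+\frac12[m,m]=0$, where $d$ is induced by the differential of $V$. Writing $m=\sum_{n\ge2}m_n$ with $m_n$ of order $n$, each $m_n$ is determined by a map $\Pi V^*\to((\Pi V^* )^{\otimes n})_{S_n}$; composing with the identification of coinvariants with invariants $x_1\otimes\cdots\otimes x_n\mapsto\sum_{\sigma\in S_n}\sigma(x_1\otimes\cdots\otimes x_n)$ and dualising gives odd (graded) symmetric multilinear maps $(\Pi V)^{\otimes n}\to\Pi V$, again denoted $m_n$. The structure is described by this collection, the Maurer–Cartan equation being equivalent to the usual $L_\infty$-relations. An $L_\infty$-morphism $(V,m_V)\to(W,m_W)$ is a morphism of commutative dg algebras $(\hat S\Pi W^*,d+m_W)\to(\hat S\Pi V^*,d+m_V)$; equivalently a collection of even symmetric multilinear maps $f_n:(\Pi V)^{\otimes n}\to\Pi W$, $n\ge1$, satisfying the corresponding relations. It is an $L_\infty$-quasi-isomorphism if its linear component $f_1:\Pi V\to\Pi W$ is a quasi-isomorphism. A strong deformation retract of $V$ onto $\mathrm H(V)$ consists of even chain maps $i:\mathrm H(V)\to V$, $p:V\to\mathrm H(V)$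 and an odd linear map $s:V\to V$ with $pi=\mathrm{id}$, $ds+sd=\mathrm{id}-ip$, $si=0$, $ps=0$, $s^2=0$; the parity shifts of $i,p,s$ are denoted by the same letters. Every vertex of a tree in $\mathrm{Tree}_n$ has at least two inputs (and exactly one output). The signs $\pm$ are determined by the tree together with Koszul signs from permuting the inputs into the order in which they occur in the tree. *)

(* Defs.v *)
From HB Require Import structures.
From mathcomp Require Import all_boot all_order all_algebra.
From mathcomp Require Import all_classical all_reals.

Set Implicit Arguments.
Unset Strict Implicit.
Unset Printing Implicit Defensive.

Import GRing.Theory.
Local Open Scope ring_scope.
Local Open Scope quotient_scope.

(* The grading is given by the projections [hcomp b] onto the part of parity
   [b] (false = even, true = odd); [hcompD] and [hcompK] together force
   hcomp b \o hcomp (~~ b) = 0. *)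
Record superSpace (R : fieldType) := SuperSpace {
  carrier :> lmodType R;
  hcomp : bool -> {linear carrier -> carrier};
  hcompD : forall v, hcomp false v + hcomp true v = v;
  hcompK : forall b v, hcomp b (hcomp b v) = hcomp b v;
  diff : {linear carrier -> carrier};
  diff_odd : forall b v, hcomp (~~ b) (diff v) = diff (hcomp b v);
  diffK : forall v, diff (diff v) = 0 }.

Arguments hcomp {R} _ _.
Arguments diff {R} _.

Definition homog (R : fieldType) (V : superSpace R) (b : bool) (v : V) : bool :=
  hcomp V b v == v.

(* Parity reversion keeps the carrier and the differential, so that a map and
   its parity shift are the same function.  Had one put the differential -d on
   the reversed space, the parity shift of a contraction s would be -s. *)
Section ParityReversion.
Variables (R : fieldType) (V : superSpace R).

Lemma Pi_hcompD (v : V) : hcomp V (~~ false) v + hcomp V (~~ true) v = v.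
Proof. by rewrite addrC hcompD. Qed.

Lemma Pi_diff_odd b (v : V) :
  hcomp V (~~ ~~ b) (diff V v) = diff V (hcomp V (~~ b) v).
Proof. by rewrite diff_odd. Qed.

Definition Pi : superSpace R :=
  @SuperSpace R V (fun b => hcomp V (~~ b)) Pi_hcompD
    (fun b => @hcompK R V (~~ b)) (diff V) Pi_diff_odd (@diffK R V).

End ParityReversion.

Section Homology.
Variables (R : fieldType) (V : superSpace R).

Definition is_cycle : {pred V} := fun v => diff V v == 0.

Fact is_cycle_submod : submod_closed is_cycle.
Proof.
split=> [|a u v /eqP du /eqP dv]; first by apply/eqP; rewrite raddf0.
by apply/eqP; rewrite linearP du dv scaler0 addr0.
Qed.

HB.instance Definition _ := GRing.isSubmodClosed.Build R V is_cycle
  is_cycle_submod.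

Record cycles := Cycle { cycle_val : V; _ : cycle_val \in is_cycle }.
HB.instance Definition _ := [isSub for cycle_val].
HB.instance Definition _ := [Choice of cycles by <:].
HB.instance Definition _ := [SubChoice_isSubLmodule of cycles by <:].

Definition is_boundary : {pred cycles} :=
  fun z => `[< exists v, diff V v = cycle_val z >].

Fact is_boundary_submod : submod_closed is_boundary.
Proof.
split=> [|a z w /asboolP[u du] /asboolP[v dv]]; apply/asboolP.
  by exists 0; rewrite raddf0.
by exists (a *: u + v); rewrite linearP du dv.
Qed.

HB.instance Definition _ := GRing.isSubmodClosed.Build R cycles is_boundary
  is_boundary_submod.

Definition homology_type : Type := Quotient.quot is_boundary.
HB.instance Definition _ := GRing.Zmodule.on homology_type.

Definition hclass (z : cycles) : homology_type :=
  \pi_(Quotient.quot is_boundary) z.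

Fact hclassP (z w : cycles) :
  reflect (hclass z = hclass w) (z - w \in is_boundary).
Proof. by rewrite Quotient.idealrBE; exact: eqP. Qed.

Fact hclass_repr (h : homology_type) : hclass (repr h) = h.
Proof. exact: reprK. Qed.

Fact hclassD (z w : cycles) : hclass (z + w) = hclass z + hclass w.
Proof. exact: raddfD. Qed.

Section Descend.
Variable f : {linear cycles -> cycles}.
Hypothesis fB : {homo f : z / z \in is_boundary}.

Definition descend (h : homology_type) : homology_type := hclass (f (repr h)).

Fact descendE z : descend (hclass z) = hclass (f z).
Proof. by apply/hclassP; rewrite -raddfB; apply/fB/hclassP/hclass_repr. Qed.

End Descend.

Fact scale_boundary (a : R) : {homo ( *:%R a) : z / z \in is_boundary}.
Proof. by move=> z; exact: rpredZ. Qed.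

Definition hscale (a : R) : homology_type -> homology_type :=
  descend (GRing.scale a).

Let hscaleE a z : hscale a (hclass z) = hclass (a *: z) :=
  descendE (@scale_boundary a) z.

Fact hscaleA a b h : hscale a (hscale b h) = hscale (a * b) h.
Proof. by rewrite -(hclass_repr h) !hscaleE scalerA. Qed.

Fact hscale1 : left_id 1 hscale.
Proof. by move=> h; rewrite -(hclass_repr h) hscaleE scale1r. Qed.

Fact hscaleDr : right_distributive hscale +%R.
Proof.
move=> a h k; rewrite -(hclass_repr h) -(hclass_repr k).
by rewrite -hclassD !hscaleE scalerDr hclassD.
Qed.

Fact hscaleDl h : {morph hscale^~ h : a b / a + b}.
Proof.
by move=> a b; rewrite -(hclass_repr h) !hscaleE scalerDl hclassD.
Qed.

HB.instance Definition _ := GRing.Zmodule_isLmodule.Build R homology_type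
  hscaleA hscale1 hscaleDr hscaleDl.

Fact hclassZ a z : hclass (a *: z) = a *: hclass z.
Proof. by rewrite -hscaleE. Qed.

Fact hcomp_cycle b (z : cycles) : hcomp V b (cycle_val z) \in is_cycle.
Proof.
case: z => v dv; apply/eqP; rewrite -(negbK b) -diff_odd.
by rewrite (eqP dv) raddf0.
Qed.

Definition cycle_comp b (z : cycles) : cycles := Cycle (hcomp_cycle b z).

Fact cycle_comp_linear b : linear (cycle_comp b).
Proof. by move=> a z w; apply: val_inj; rewrite /= !linearP. Qed.

HB.instance Definition _ b := GRing.isLinear.Build R cycles cycles *:%R
  (cycle_comp b) (cycle_comp_linear b).

Fact cycle_comp_boundary b : {homo cycle_comp b : z / z \in is_boundary}.
Proof.
move=> z /asboolP[v dv]; apply/asboolP; exists (hcomp V (~~ b) v).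
by rewrite -diff_odd negbK dv.
Qed.

Definition homology_comp b : homology_type -> homology_type :=
  descend (cycle_comp b).

Let homology_compE b z :
  homology_comp b (hclass z) = hclass (cycle_comp b z) :=
  descendE (@cycle_comp_boundary b) z.

Fact homology_comp_linear b : linear (homology_comp b).
Proof.
move=> a h k; rewrite -(hclass_repr h) -(hclass_repr k).
by rewrite -hclassZ -hclassD !homology_compE linearP hclassD hclassZ.
Qed.

HB.instance Definition _ b := GRing.isLinear.Build R homology_type
  homology_type *:%R (homology_comp b) (homology_comp_linear b).

Fact homology_compD h : homology_comp false h + homology_comp true h = h.
Proof.
rewrite -(hclass_repr h) !homology_compE -hclassD; congr hclass.
by apply: val_inj; rewrite /= hcompD.
Qed.

Fact homology_compK b h : homology_comp b (homology_comp b h) = homology_comp b h.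
Proof.
rewrite -(hclass_repr h) !homology_compE; congr hclass.
by apply: val_inj; rewrite /= hcompK.
Qed.

Fact homology_diff_odd b h :
  homology_comp (~~ b) (\0 h) = \0 (homology_comp b h) :> homology_type.
Proof. by rewrite /= raddf0. Qed.

Definition homology : superSpace R :=
  @SuperSpace R homology_type homology_comp homology_compD homology_compK
    \0 homology_diff_odd (fun=> erefl).

End Homology.

Definition quasi_iso (R : fieldType) (V W : superSpace R) (f : V -> W) : Prop :=
  (forall v, f (diff V v) = diff W (f v)) /\
  exists2 g : homology V -> homology W, bijective g &
    forall (z : cycles V) (w : cycles W),
      cycle_val w = f (cycle_val z) -> g (hclass z) = hclass w.

Record strong_retract (R : fieldType) (V H : superSpace R)
    (i : {linear H -> V}) (p : {linear V -> H}) (s : {linear V -> V}) : Prop :=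
  StrongRetract {
    retract_i_even : forall b h, hcomp V b (i h) = i (hcomp H b h);
    retract_p_even : forall b v, hcomp H b (p v) = p (hcomp V b v);
    retract_s_odd : forall b v, hcomp V (~~ b) (s v) = s (hcomp V b v);
    retract_i_chain : forall h, i (diff H h) = diff V (i h);
    retract_p_chain : forall v, p (diff V v) = diff H (p v);
    retract_pi : forall h, p (i h) = h;
    retract_ds : forall v, diff V (s v) + s (diff V v) = v - i (p v);
    retract_si : forall h, s (i h) = 0;
    retract_ps : forall v, p (s v) = 0;
    retract_ss : forall v, s (s v) = 0 }.

(* A family of maps f_n : U^n -> W is encoded as one function on sequences,
   f_n being its restriction to the sequences of length n. *)
Section Families.
Variables (R : fieldType) (U W : superSpace R) (f : seq U -> W).

Definition multilinear : Prop := forall u v a x y,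
  f (u ++ (a *: x + y) :: v) = a *: f (u ++ x :: v) + f (u ++ y :: v).

(* Adjacent transpositions generate the symmetric group. *)
Definition graded_symmetric : Prop := forall u v b c x y,
  homog b x -> homog c y ->
  f (u ++ x :: y :: v) = (-1) ^+ (b && c) *: f (u ++ y :: x :: v).

Definition has_parity (q : bool) : Prop := forall e u,
  all2 (@homog R U) e u -> homog (q (+) odd (count id e)) (f u).

End Families.

(* The exponent of the Koszul sign arising when inputs of parities [e],
   given in the order 0, ..., n-1, are rearranged into the order [w]. *)
Fixpoint koszul n (e : 'I_n -> bool) (w : seq 'I_n) : bool :=
  if w is j :: w' then
    (e j && odd (count (fun k : 'I_n => (k < j)%N && e k) w')) (+) koszul e w'
  else false.

Definition with_diff (R : fieldType) (V : superSpace R)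
    (m : seq (Pi V) -> Pi V) (u : seq (Pi V)) : Pi V :=
  if u is [:: x] then diff (Pi V) x else m u.

Record Linfty_algebra (R : fieldType) (V : superSpace R)
    (m : seq (Pi V) -> Pi V) : Prop := LinftyAlgebra {
  Linfty_small : forall u, (size u < 2)%N -> m u = 0;
  Linfty_multilinear : multilinear m;
  Linfty_symmetric : graded_symmetric m;
  Linfty_odd : has_parity m true;
  (* The Maurer-Cartan equation d(m) + [m,m]/2 = 0, evaluated on n inputs.
     The m_n are dual to m under the identification of coinvariants with
     invariants by the unnormalised sum over S_n, so there are no factorials:
     each splitting of the inputs into two sets occurs once. *)
  Linfty_relation : forall n (e : 'I_n -> bool) (x : 'I_n -> Pi V),
    (forall j, homog (e j) (x j)) ->
    \sum_(A : {set 'I_n} | (0 < #|A|)%N)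
      (-1) ^+ koszul e (enum A ++ enum (~: A)) *:
        with_diff m (with_diff m (map x (enum A)) :: map x (enum (~: A))) = 0 }.

Record Linfty_morphism (R : fieldType) (V W : superSpace R)
    (mV : seq (Pi V) -> Pi V) (mW : seq (Pi W) -> Pi W)
    (f : seq (Pi V) -> Pi W) : Prop := LinftyMorphism {
  morphism_nil : f [::] = 0;
  morphism_multilinear : multilinear f;
  morphism_symmetric : graded_symmetric f;
  morphism_even : has_parity f false;
  (* The identity F \o (d + mW) = (d + mV) \o F for the algebra morphism F
     dual to f.  The sum on the right is over the unordered partitions P of the
     inputs; the order in which [enum P] lists the blocks is immaterial, by
     graded symmetry of mW. *)
  morphism_relation : forall n (e : 'I_n -> bool) (x : 'I_n -> Pi V),
    (0 < n)%N -> (forall j, homog (e j) (x j)) ->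
    \sum_(A : {set 'I_n} | (0 < #|A|)%N)
      (-1) ^+ koszul e (enum A ++ enum (~: A)) *:
        f (with_diff mV (map x (enum A)) :: map x (enum (~: A))) =
    \sum_(P : {set {set 'I_n}} | finset.partition P finset.setT)
      (-1) ^+ koszul e (flatten [seq enum B | B : {set 'I_n} <- enum P]) *:
        with_diff mW [seq f (map x (enum B)) | B : {set 'I_n} <- enum P] }.

Definition Linfty_quasi_iso (R : fieldType) (V W : superSpace R)
    (mV : seq (Pi V) -> Pi V) (mW : seq (Pi W) -> Pi W)
    (f : seq (Pi V) -> Pi W) : Prop :=
  Linfty_morphism mV mW f /\
  @quasi_iso R (Pi V) (Pi W) (fun x => f [:: x]).

(* [GenTree.Node k ts] is a vertex with list of inputs [ts]; its label [k]
   is required to be the number of inputs. *)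
Definition tree n : Type := GenTree.tree 'I_n.
HB.instance Definition _ n := Choice.on (tree n).

Section Trees.
Variable n : nat.

Fixpoint leaves (t : tree n) : seq 'I_n :=
  match t with
  | GenTree.Leaf j => [:: j]
  | GenTree.Node _ ts => flatten [seq leaves t' | t' <- ts]
  end.

Definition least_leaf (t : tree n) : nat :=
  foldr minn n [seq nat_of_ord j | j <- leaves t].

(* Listing the inputs of every vertex by increasing least leaf selects exactly
   one planar representative of each isomorphism class of rooted trees. *)
Fixpoint well_formed (t : tree n) : bool :=
  match t with
  | GenTree.Leaf _ => true
  | GenTree.Node k ts =>
      [&& k == size ts, (1 < k)%N, all well_formed ts
        & sorted ltn [seq least_leaf t' | t' <- ts]]
  end.

Definition Tree : set (tree n) :=
  [set t | well_formed t && perm_eq (leaves t) (enum 'I_n)]%classic.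

End Trees.

Arguments Tree n : clear implicits.

(* As s and the m_k are odd, each branch s(m_k(...)) is an even map, so no sign
   arises when branches are evaluated on elements. *)
Section TreeMap.
Variables (R : fieldType) (V H : superSpace R).
Variables (i : Pi H -> Pi V) (s : Pi V -> Pi V) (p : Pi V -> Pi H).
Variables (m : seq (Pi V) -> Pi V) (n : nat) (x : 'I_n -> Pi H).

Fixpoint branch_map (t : tree n) : Pi V :=
  match t with
  | GenTree.Leaf j => i (x j)
  | GenTree.Node _ ts => s (m [seq branch_map t' | t' <- ts])
  end.

Definition tree_map (t : tree n) : Pi H :=
  match t with
  | GenTree.Leaf j => p (i (x j))
  | GenTree.Node _ ts => p (m [seq branch_map t' | t' <- ts])
  end.

End TreeMap.

(* Main.v *)
From HB Require Import structures.
Require Import Defs.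
From mathcomp Require Import all_boot all_order all_algebra.
From mathcomp Require Import zify.
From mathcomp Require Import all_classical all_reals.

(* Write Q = d + m for the odd vector field on Pi V and solve the fixed point
   equation f(h) = i h - s m(f(h)), which is recursive in the number of inputs;
   unfolding it gives the sum over trees, one sign for each internal edge.  Put
   l(h) = p m(f(h)).  Differentiating the fixed point equation in the direction
   l(h), and using ds + sd = 1 - ip together with the Maurer-Cartan equation
   d m(x) + m'(x)[Q(x)] = 0 at x = f(h), the difference
   W(h) = Q(f(h)) - f'(h)[l(h)] satisfies W = - s m'(f(h))[W].  As m has order
   at least 2, W = 0 by induction on the number of inputs: f is a morphism.
   Moreover l'(h)[l(h)] = p m'(f(h))[Q(f(h))] = - p d m(f(h)) = 0.

   These power series are handled through their multilinear parts, functions of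
   words in homogeneous letters: products become signed sums over unshuffles,
   composition becomes signed sums over set partitions, and differentiation
   adds a letter at the head of a word. *)

Set Implicit Arguments.
Unset Strict Implicit.
Unset Printing Implicit Defensive.

Import GRing.Theory.
Local Open Scope ring_scope.

(** * Signed sums over unshuffles and set partitions *)

(** The obstacle is the bookkeeping of signs. The definitions index their sums by subsets and set
    partitions, with signs counting inversions and with blocks in whatever order [enum] gives them;
    this does not lend itself to induction. Unshuffles of a word are generated letter by letter, so
    that coassociativity, graded commutativity and the group-like property become inductions on the
    head letter, in which only the passage of one letter has to be counted. The two descriptions are
    compared once, on the increasing word of all inputs, where the sign collected by the recursion
    is exactly the number of odd inversions mod 2. Letters carry their parity as a tag: signs are
    then Boolean functions of the word, and a value such as l(h), of opposite parity, can be
    reinserted as a letter. Forgetting the tags means summing over the even and odd parts of every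
    input. The fixed point exists because a partition on which m can be nonzero has at least two
    blocks, all shorter than the word. *)

Definition par (T : Type) (e : T -> bool) (w : seq T) : bool := odd (count e w).

Section Parity.
Variables (T : Type) (e : T -> bool).

Lemma par_cons x w : par e (x :: w) = e x (+) par e w.
Proof. by rewrite /par /= oddD; case: (e x). Qed.

Lemma par_cat u v : par e (u ++ v) = par e u (+) par e v.
Proof. by rewrite /par count_cat oddD. Qed.

End Parity.

Lemma par_flatten (T : Type) (e : T -> bool) (P : seq (seq T)) :
  par e (flatten P) = par (par e) P.
Proof. by elim: P => [|B P IH] //=; rewrite par_cat par_cons IH. Qed.

Lemma par_perm (T : eqType) (e : T -> bool) (u v : seq T) :
  perm_eq u v -> par e u = par e v.
Proof. by move=> /permP uv; rewrite /par uv. Qed.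

Section Sums.
Variables (R : fieldType) (T : eqType) (e : T -> bool).
Implicit Types (M : lmodType R) (w a b : seq T).

(* The Boolean is the exponent of the Koszul sign of the unshuffle. *)
Fixpoint unshuffles w : seq (bool * seq T * seq T) :=
  if w is x :: w' then
    [seq (z.1.1, x :: z.1.2, z.2) | z <- unshuffles w'] ++
    [seq (z.1.1 (+) (e x && par e z.1.2), z.1.2, x :: z.2) | z <- unshuffles w']
  else [:: (false, [::], [::])].

(** For [g a b] a product of multilinear parts, this is the value on [w] of the product of two power
    series. *)
Definition shsum M w (g : seq T -> seq T -> M) : M :=
  \sum_(z <- unshuffles w) (-1) ^+ z.1.1 *: g z.1.2 z.2.

Lemma unshuffles_perm w z : z \in unshuffles w -> perm_eq (z.1.2 ++ z.2) w.
Proof.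
elim: w z => [|x w IH] z /=; first by rewrite inE => /eqP->.
rewrite mem_cat => /orP[] /mapP[y /IH yw ->] /=; first by rewrite perm_cons.
by rewrite (perm_catCA y.1.2 [:: x] y.2) /= perm_cons.
Qed.

Section ShsumTheory.
Variable M : lmodType R.
Implicit Types g h : seq T -> seq T -> M.

Lemma shsum_nil g : shsum [::] g = g [::] [::].
Proof. by rewrite /shsum big_seq1 scale1r. Qed.

Lemma eq_shsum w g h :
  (forall a b, perm_eq (a ++ b) w -> g a b = h a b) -> shsum w g = shsum w h.
Proof.
by move=> gh; apply: eq_big_seq => z /unshuffles_perm zw; rewrite gh.
Qed.

Lemma shsum_cons x w g :
  shsum (x :: w) g =
  shsum w (fun a b => g (x :: a) b + (-1) ^+ (e x && par e a) *: g a (x :: b)).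
Proof.
rewrite /shsum big_cat !big_map /= -big_split; apply: eq_bigr => z _ /=.
by rewrite scalerDr scalerA -signr_addb.
Qed.

Lemma shsumD w g h :
  shsum w (fun a b => g a b + h a b) = shsum w g + shsum w h.
Proof. by rewrite -big_split; apply: eq_bigr => z _; rewrite scalerDr. Qed.

Lemma shsumZ w c g : shsum w (fun a b => c *: g a b) = c *: shsum w g.
Proof.
by rewrite scaler_sumr; apply: eq_bigr => z _; rewrite !scalerA mulrC.
Qed.

Lemma shsumN w g : shsum w (fun a b => - g a b) = - shsum w g.
Proof. by rewrite -sumrN; apply: eq_bigr => z _; rewrite scalerN. Qed.

Lemma shsum0 w : shsum w (fun _ _ => 0 : M) = 0.
Proof. by apply: big1 => z _; rewrite scaler0. Qed.

Lemma shsum_linear (N : lmodType R) (phi : {linear N -> M}) w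
    (g : seq T -> seq T -> N) :
  phi (shsum w g) = shsum w (fun a b => phi (g a b)).
Proof. by rewrite linear_sum; apply: eq_bigr => z _; rewrite linearZ. Qed.

(* The only surviving unshuffle leaves nothing in the second factor. *)
Lemma shsum_right_nil w (g : seq T -> M) :
  shsum w (fun a b => if b is [::] then g a else 0) = g w.
Proof.
elim: w g => [|x w IH] g; first by rewrite shsum_nil.
rewrite shsum_cons -(IH (fun a => g (x :: a))); apply: eq_shsum => a b _.
by rewrite scaler0 addr0.
Qed.

(** Coassociativity: on both sides the head letter goes to one of three places, with the sign of
    passing the letters in the earlier places. *)
Lemma shsumA w (g : seq T -> seq T -> seq T -> M) :
  shsum w (fun a b => shsum a (fun a1 a2 => g a1 a2 b)) =
  shsum w (fun a b => shsum b (fun b1 b2 => g a b1 b2)).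
Proof.
elim: w g => [|x w IH] g; first by rewrite !shsum_nil.
rewrite !shsum_cons.
transitivity (shsum w (fun a b => shsum a (fun a1 a2 =>
   g (x :: a1) a2 b + (-1) ^+ (e x && par e a1) *: (g a1 (x :: a2) b +
     (-1) ^+ (e x && par e a2) *: g a1 a2 (x :: b))))).
  apply: eq_shsum => a b _; rewrite shsum_cons -shsumZ -shsumD.
  apply: eq_shsum => a1 a2 /(par_perm e); rewrite par_cat => <-.
  rewrite -addrA scalerDr scalerA -signr_addb; do 2 congr (_ + _).
  by case: (e x).
rewrite IH; apply: eq_shsum => a b _; rewrite shsum_cons -shsumZ -shsumD.
exact: eq_shsum.
Qed.

Lemma shsumC w g :
  shsum w g = shsum w (fun a b => (-1) ^+ (par e a && par e b) *: g b a).
Proof.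
elim: w g => [|x w IH] g; first by rewrite !shsum_nil scale1r.
rewrite !shsum_cons IH; apply: eq_shsum => a b _.
rewrite addrC !par_cons scalerDr !scalerA -!signr_addb.
congr (_ + _); congr (_ ^+ nat_of_bool _ *: _);
  by case: (e x); case: (par e a); case: (par e b).
Qed.

Lemma shsumCA w (g : seq T -> seq T -> seq T -> M) :
  shsum w (fun a b => shsum b (fun b1 b2 => g a b1 b2)) =
  shsum w (fun a b => shsum b (fun b1 b2 =>
    (-1) ^+ (par e a && par e b1) *: g b1 a b2)).
Proof. by rewrite -!shsumA; apply: eq_shsum => a b _; rewrite shsumC. Qed.

End ShsumTheory.

(* The first argument bounds the number of blocks. *)
Fixpoint partitions_rec n w : seq (bool * seq (seq T)) :=
  if w is x :: w' then
    if n is n'.+1 then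
      flatten [seq [seq (z.1.1 (+) P.1, (x :: z.1.2) :: P.2)
        | P <- partitions_rec n' z.2] | z <- unshuffles w']
    else [::]
  else [:: (false, [::])].

(* In each partition the blocks are listed by first letter. *)
Definition partitions w := partitions_rec (size w) w.

(** For [g P := m (map f P)] with f even, this is the value on [w] of the composite m(f(h));
    unordered blocks replace the factorials of the exponential. *)
Definition ptsum M w (g : seq (seq T) -> M) : M :=
  \sum_(P <- partitions w) (-1) ^+ P.1 *: g P.2.

Lemma partitions_recS n x w :
  partitions_rec n.+1 (x :: w) =
  flatten [seq [seq (z.1.1 (+) P.1, (x :: z.1.2) :: P.2)
    | P <- partitions_rec n z.2] | z <- unshuffles w].
Proof. by []. Qed.

Lemma partitions_recE n w : (size w <= n)%N ->
  partitions_rec n w = partitions w.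
Proof.
rewrite /partitions; elim/ltn_ind: n w => n IH [|x w]; first by case: n IH.
case: n IH => // n IH; rewrite ltnS => wn; rewrite [size _]/= !partitions_recS.
congr flatten; apply/eq_in_map => z /unshuffles_perm /perm_size.
rewrite size_cat => zw; have bw : (size z.2 <= size w)%N by rewrite -zw
  leq_addl.
by rewrite (IH n) ?(leq_trans bw) // (IH (size w)).
Qed.

Lemma partitions_cons x w :
  partitions (x :: w) =
  flatten [seq [seq (z.1.1 (+) P.1, (x :: z.1.2) :: P.2)
    | P <- partitions z.2] | z <- unshuffles w].
Proof.
rewrite {1}/partitions [size _]/= partitions_recS; congr flatten.
apply/eq_in_map => z /unshuffles_perm /perm_size; rewrite size_cat => zw.
by rewrite partitions_recE // -zw leq_addl.
Qed.

Definition partition_spec w P :=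
  all (fun B => B != [::]) P && perm_eq (flatten P) w.

Lemma partitions_spec w P : P \in partitions w -> partition_spec w P.2.
Proof.
have [n] := ubnP (size w); elim: n w P => // n IH [|x w] P.
  by rewrite inE => _ /eqP->.
rewrite /= ltnS => wn; rewrite partitions_cons => /flattenP[s /mapP[z zw ->]].
case/mapP=> Q Qz ->; have {}zw := unshuffles_perm zw.
have zn : (size z.2 < n)%N.
  by apply: leq_ltn_trans wn; rewrite -(perm_size zw) size_cat leq_addl.
have /andP[Q1 Q2] := IH _ _ zn Qz; rewrite /partition_spec /= Q1 /= perm_cons.
by rewrite (perm_trans _ zw) // perm_cat2l.
Qed.

Section PtsumTheory.
Variable M : lmodType R.
Implicit Types g h : seq (seq T) -> M.

Lemma ptsum_nil g : ptsum [::] g = g [::].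
Proof. by rewrite /ptsum big_seq1 scale1r. Qed.

(** The rule (exp f)' = f' exp f: the head letter selects its block and the other letters are
    partitioned freely. It stays in front, so it adds no sign. *)
Lemma ptsum_cons x w g :
  ptsum (x :: w) g =
  shsum w (fun a b => ptsum b (fun P => g ((x :: a) :: P))).
Proof.
rewrite /ptsum partitions_cons big_flatten big_map; apply: eq_bigr => z _.
rewrite big_map scaler_sumr; apply: eq_bigr => P _.
by rewrite /= scalerA -signr_addb.
Qed.

Lemma eq_ptsum w g h :
  (forall P, partition_spec w P -> g P = h P) -> ptsum w g = ptsum w h.
Proof.
by move=> gh; apply: eq_big_seq => P /partitions_spec Pw; rewrite gh.
Qed.

Lemma ptsumD w g h : ptsum w (fun P => g P + h P) = ptsum w g + ptsum w h.
Proof. by rewrite -big_split; apply: eq_bigr => z _; rewrite scalerDr. Qed.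

Lemma ptsumZ w c g : ptsum w (fun P => c *: g P) = c *: ptsum w g.
Proof.
by rewrite scaler_sumr; apply: eq_bigr => z _; rewrite !scalerA mulrC.
Qed.

Lemma ptsum0 w : ptsum w (fun _ => 0 : M) = 0.
Proof. by apply: big1 => z _; rewrite scaler0. Qed.

Lemma ptsum_linear (N : lmodType R) (phi : {linear N -> M}) w
    (g : seq (seq T) -> N) :
  phi (ptsum w g) = ptsum w (fun P => phi (g P)).
Proof. by rewrite linear_sum; apply: eq_bigr => z _; rewrite linearZ. Qed.

Lemma ptsum_shsum w v (g : seq (seq T) -> seq T -> seq T -> M) :
  ptsum w (fun P => shsum v (g P)) =
  shsum v (fun a b => ptsum w (fun P => g P a b)).
Proof.
rewrite /ptsum /shsum; under eq_bigr do rewrite scaler_sumr.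
rewrite exchange_big /=; apply: eq_bigr => z _.
by rewrite scaler_sumr; apply: eq_bigr => P _; rewrite !scalerA mulrC.
Qed.

End PtsumTheory.

End Sums.

Lemma shsum_map (R : fieldType) (M : lmodType R) (T S : eqType) (e : T -> bool)
    (d : S -> bool) (h : T -> S) (w : seq T) (g : seq S -> seq S -> M) :
  (forall x, d (h x) = e x) ->
  shsum d (map h w) g = shsum e w (fun a b => g (map h a) (map h b)).
Proof.
move=> dh; elim: w g => [|x w IH] g /=; first by rewrite !shsum_nil.
rewrite !shsum_cons IH; apply: eq_shsum => a b _.
by rewrite dh /par count_map; congr (_ + (-1) ^+ nat_of_bool (_ && odd _) *: _);
  apply: eq_count.
Qed.

Lemma ptsum_map (R : fieldType) (M : lmodType R) (T S : eqType) (e : T -> bool)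
    (d : S -> bool) (h : T -> S) (w : seq T) (g : seq (seq S) -> M) :
  (forall x, d (h x) = e x) ->
  ptsum d (map h w) g = ptsum e w (fun P => g (map (map h) P)).
Proof.
move=> dh; have [n] := ubnP (size w); elim: n w g => // n IH [|x w] g /= wn.
  by rewrite !ptsum_nil.
rewrite !ptsum_cons (shsum_map (e := e)) //; apply: eq_shsum => a b /perm_size.
rewrite size_cat => ab; rewrite IH // -ltnS; apply: leq_trans wn.
by rewrite !ltnS -ab leq_addl.
Qed.

(* The exponential of an even element is group-like for the comultiplication. *)
Lemma ptsum_shsum_par (R : fieldType) (M : lmodType R) (T : eqType)
    (e : T -> bool) (w : seq T) (g : seq (seq T) -> seq (seq T) -> M) :
  ptsum e w (fun P => shsum (par e) P g) =
  shsum e w (fun a b => ptsum e a (fun P1 => ptsum e b (fun P2 => g P1 P2))).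
Proof.
have [n] := ubnP (size w); elim: n w g => // n IH [|x w] g /=;
  rewrite ?ltnS => wn.
  by rewrite ptsum_nil !shsum_nil !ptsum_nil.
rewrite ptsum_cons shsum_cons.
under [RHS]eq_shsum do rewrite ptsum_cons.
rewrite [RHS]shsumD shsumA.
(* The block of [x] falls into the first or the second group; in the second case it passes the
   blocks of [P1], whose total parity is that of [b1]. *)
transitivity (shsum e w (fun a b => shsum e b (fun b1 b2 =>
    ptsum e b1 (fun P1 => ptsum e b2 (fun P2 => g ((x :: a) :: P1) P2)) +
    (-1) ^+ (par e (x :: a) && par e b1) *:
     ptsum e b1 (fun P1 => ptsum e b2 (fun P2 => g P1 ((x :: a) :: P2)))))).
  apply: eq_shsum => a b /perm_size; rewrite size_cat => ab.
  under eq_ptsum do rewrite shsum_cons.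
  rewrite IH ?(leq_ltn_trans _ wn) -?ab ?leq_addl //.
  apply: eq_shsum => b1 b2 _; rewrite -ptsumZ -ptsumD; apply: eq_ptsum => P1.
  move=> /andP[_ /(par_perm e)]; rewrite par_flatten => <-.
  by rewrite -ptsumZ -ptsumD.
under eq_shsum do rewrite shsumD.
rewrite shsumD; congr (_ + _); rewrite shsumCA.
apply: eq_shsum => a b _.
under eq_ptsum do rewrite ptsum_cons.
rewrite ptsum_shsum -shsumZ; apply: eq_shsum => b1 b2 _.
rewrite scalerA -signr_addb par_cons; congr (_ ^+ nat_of_bool _ *: _).
by case: (e x); case: (par e a); case: (par e b1).
Qed.

(** * Graded symmetry and linearity of the signed sums *)

Section LocalRelations.
Variables (R : fieldType) (T : eqType) (e : T -> bool) (M : lmodType R).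

(* The bound on the length of the remaining letters allows proofs by induction
   on the words. *)
Definition swaps n x y (g : seq T -> M) : Prop := forall u v,
  (size u + size v <= n)%N ->
  g (u ++ x :: y :: v) = (-1) ^+ (e x && e y) *: g (u ++ y :: x :: v).

Definition combines n c x y z (g : seq T -> M) : Prop := forall u v,
  (size u + size v <= n)%N ->
  g (u ++ z :: v) = c *: g (u ++ x :: v) + g (u ++ y :: v).

(** If both letters fall into the same half, the hypotheses apply; the two terms that separate them
    trade places, the sign coming from [shsum_cons]. *)
Lemma shsum_swaps n x y (g : seq T -> seq T -> M) :
  (forall b, swaps n x y (g ^~ b)) -> (forall a, swaps n x y (g a)) ->
  swaps n x y (fun w => shsum e w g).
Proof.
move=> gl gr u v; elim: u n g gl gr => [|z u IH] n g gl gr uv.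
  rewrite /= !shsum_cons -shsumZ; apply: eq_shsum => a b /perm_size.
  rewrite size_cat => ab.
  rewrite !par_cons (gl b [::] a) ?(gr a [::] b) /=;
    do ?by rewrite (leq_trans _ uv) // -ab ?leq_addl ?leq_addr.
  rewrite !scalerDr !scalerA -!signr_addb -!addrA; congr (_ + _).
  rewrite addrCA; congr (_ *: _ + (_ *: _ + _ *: _));
    congr (_ ^+ nat_of_bool _);
    by case: (e x); case: (e y); case: (par e a).
case: n gl gr uv => // n gl gr uv.
rewrite /= !shsum_cons; apply: (IH n) => // [b|a] u' v' uv'.
  rewrite (gl b (z :: u')) // (gl (z :: b) u') 1?ltnW //.
  rewrite !(par_cat, par_cons) scalerDr !scalerA mulrC; congr (_ + _ *: _).
  by congr (_ * _ ^+ nat_of_bool _); rewrite [e x (+) (e y (+) _)]addbCA.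
rewrite (gr (z :: a) u') 1?ltnW // (gr a (z :: u')) //.
by rewrite scalerDr !scalerA mulrC.
Qed.

Lemma shsum_combines n c x y z (g : seq T -> seq T -> M) :
  e x = e z -> e y = e z ->
  (forall b, combines n c x y z (g ^~ b)) ->
  (forall a, combines n c x y z (g a)) ->
  combines n c x y z (fun w => shsum e w g).
Proof.
move=> xz yz gl gr u v; elim: u n g gl gr => [|t u IH] n g gl gr uv.
  rewrite /= !shsum_cons -shsumZ -shsumD; apply: eq_shsum => a b /perm_size.
  rewrite size_cat => ab; rewrite xz yz.
  rewrite (gl b [::] a) ?(gr a [::] b) /=;
    do ?by rewrite (leq_trans _ uv) // -ab ?leq_addl ?leq_addr.
  rewrite !scalerDr !scalerA mulrC -!addrA; congr (_ + _).
  by rewrite addrCA.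
case: n gl gr uv => // n gl gr uv.
rewrite /= !shsum_cons; apply: (IH n) => // [b|a] u' v' uv'.
  rewrite (gl b (t :: u')) // (gl (t :: b) u') 1?ltnW //.
  rewrite !(par_cat, par_cons) xz yz !scalerDr !scalerA mulrC -!addrA.
  by congr (_ + _); rewrite addrCA.
rewrite (gr (t :: a) u') 1?ltnW // (gr a (t :: u')) //.
rewrite !scalerDr !scalerA mulrC -!addrA.
by congr (_ + _); rewrite addrCA.
Qed.

(** Either both letters share the first block, or each heads its own block and exchanging the
    letters exchanges the first two blocks. *)
Lemma ptsum_swap_head n x y v (g : seq (seq T) -> M) :
  (size v <= n)%N ->
  (forall P Q, swaps n x y (fun B => g (P ++ B :: Q))) ->
  (forall P Q B C, g (P ++ B :: C :: Q) =
     (-1) ^+ (par e B && par e C) *: g (P ++ C :: B :: Q)) ->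
  ptsum e (x :: y :: v) g =
  (-1) ^+ (e x && e y) *: ptsum e (y :: x :: v) g.
Proof.
move=> vn gB gP; rewrite !ptsum_cons !shsum_cons !shsumD scalerDr.
under [X in _ + X = _]eq_shsum do rewrite ptsum_cons -shsumZ.
under [X in _ = _ + _ *: X]eq_shsum do rewrite ptsum_cons -shsumZ.
congr (_ + _); rewrite -shsumZ.
  apply: eq_shsum => a b /perm_size; rewrite size_cat => ab.
  rewrite -ptsumZ; apply: eq_ptsum => P _.
  by rewrite (gB [::] P [::]) //= (leq_trans _ vn) // -ab leq_addr.
rewrite shsumCA; apply: eq_shsum => a b _; rewrite -shsumZ.
apply: eq_shsum => b1 b2 _; rewrite -!ptsumZ; apply: eq_ptsum => P _.
rewrite (gP [::] P (x :: b1) (y :: a)) !scalerA -!signr_addb !par_cons.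
congr (_ ^+ nat_of_bool _ *: _).
by case: (e x); case: (e y); case: (par e a); case: (par e b1).
Qed.

Lemma ptsum_swaps n x y (g : seq (seq T) -> M) :
  (forall P Q, swaps n x y (fun B => g (P ++ B :: Q))) ->
  (forall P Q B C, g (P ++ B :: C :: Q) =
     (-1) ^+ (par e B && par e C) *: g (P ++ C :: B :: Q)) ->
  swaps n x y (fun w => ptsum e w g).
Proof.
elim: n g => [|n IH] g gB gP [|z u] v uv //; last first.
- rewrite /= !ptsum_cons.
  apply: (shsum_swaps (n := n)) => // [b|a] u' v' uv'.
    rewrite -ptsumZ; apply: eq_ptsum => P _.
    exact: (gB [::] P (z :: u')).
  apply: IH => // [P Q u1 v1 uv1|P Q B C].
    by apply: (gB ((z :: a) :: P)); rewrite ltnW.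
  exact: (gP ((z :: a) :: P)).
- exact: (ptsum_swap_head (n := n.+1)).
- exact: (ptsum_swap_head (n := 0)).
Qed.

Lemma ptsum_combines n c x y z (g : seq (seq T) -> M) :
  e x = e z -> e y = e z ->
  (forall P Q, combines n c x y z (fun B => g (P ++ B :: Q))) ->
  combines n c x y z (fun w => ptsum e w g).
Proof.
move=> xz yz; elim: n g => [|n IH] g gB [|t u] v uv //.
- rewrite /= !ptsum_cons -shsumZ -shsumD; apply: eq_shsum => a b /perm_size.
  rewrite size_cat => ab; rewrite -ptsumZ -ptsumD; apply: eq_ptsum => P _.
  by rewrite (gB [::] P [::]) //= (leq_trans _ uv) // -ab leq_addr.
- rewrite /= !ptsum_cons -shsumZ -shsumD; apply: eq_shsum => a b /perm_size.
  rewrite size_cat => ab; rewrite -ptsumZ -ptsumD; apply: eq_ptsum => P _.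
  by rewrite (gB [::] P [::]) //= (leq_trans _ uv) // -ab leq_addr.
rewrite /= !ptsum_cons.
apply: (shsum_combines (n := n)) => // [b|a] u' v' uv'.
  rewrite -ptsumZ -ptsumD; apply: eq_ptsum => P _.
  exact: (gB [::] P (t :: u')).
by apply: IH => // P Q u1 v1 uv1; apply: (gB ((t :: a) :: P)); rewrite ltnW.
Qed.
End LocalRelations.

Section PartitionSpec.
Variables (R : fieldType) (T : eqType) (e : T -> bool) (M : lmodType R).

Lemma ptsum_ptsum (v w : seq T) (g : seq (seq T) -> seq (seq T) -> M) :
  ptsum e v (fun P => ptsum e w (g P)) =
  ptsum e w (fun Q => ptsum e v (g ^~ Q)).
Proof.
rewrite /ptsum; under eq_bigr do rewrite scaler_sumr.
rewrite exchange_big /=; apply: eq_bigr => z _.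
by rewrite scaler_sumr; apply: eq_bigr => P _; rewrite !scalerA mulrC.
Qed.

Lemma ptsum_if_nil (w : seq T) (c : M) :
  ptsum e w (fun P => if P is [::] then c else 0) = if w is [::] then c else 0.
Proof.
case: w => [|x w]; first by rewrite ptsum_nil.
rewrite -[RHS](ptsum0 e M (x :: w)); apply: eq_ptsum => -[|//].
by case/andP=> _ /perm_size.
Qed.

(** Extracts the linear term of a composite. The empty word has only the partition without blocks,
    whence the value 0 there. *)
Lemma ptsum_if_single (w : seq T) (g : seq T -> M) :
  ptsum e w (fun P => if P is [:: B] then g B else 0) =
  if w is [::] then 0 else g w.
Proof.
case: w => [|x w]; first by rewrite ptsum_nil.
rewrite ptsum_cons -(shsum_right_nil e w (fun a => g (x :: a))).
apply: eq_shsum => a b _; rewrite -ptsum_if_nil.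
by apply: eq_ptsum => -[].
Qed.

Lemma size_partition (P : seq (seq T)) :
  all (fun B => B != [::]) P -> (size P <= size (flatten P))%N.
Proof.
elim: P => //= B P IH /andP[B0 /IH P0]; rewrite size_cat.
by case: B B0 => // x B _; rewrite addSn ltnS (leq_trans P0) // leq_addl.
Qed.

(** Any other block is nonempty and takes a letter away. This is what makes the fixed point equation
    a recursion on length. *)
Lemma size_block (w : seq T) P B :
  partition_spec w P -> B \in P -> (1 < size P)%N -> (size B < size w)%N.
Proof.
move=> /andP[P0 /perm_size <-] /path.splitPr.
move=> PB; case: PB P0 => P1 P2; rewrite all_cat /= => /and3P[P10 _ P20].
rewrite flatten_cat /= !size_cat /= addnS ltnS => P12.
have := leq_add (size_partition P10) (size_partition P20).
by move/(leq_trans P12); lia.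
Qed.

End PartitionSpec.

(** * Homogeneous elements and multilinear maps *)

Section Homogeneous.
Variables (R : fieldType) (U : superSpace R).

Lemma homog0 b : homog b (0 : U).
Proof. by rewrite /homog raddf0. Qed.

Lemma homogD b (x y : U) : homog b x -> homog b y -> homog b (x + y).
Proof. by move=> /eqP x_b /eqP y_b; rewrite /homog raddfD /= x_b y_b. Qed.

Lemma homogN b (x : U) : homog b x -> homog b (- x).
Proof. by move=> /eqP x_b; rewrite /homog raddfN /= x_b. Qed.

Lemma homogZ b c (x : U) : homog b x -> homog b (c *: x).
Proof. by move=> /eqP x_b; rewrite /homog linearZ /= x_b. Qed.

Lemma hcompNK b (x : U) : hcomp U (~~ b) (hcomp U b x) = 0.
Proof.
have := hcompD (hcomp U b x); case: b => /=; rewrite hcompK.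
  by move/eqP; rewrite -subr_eq0 addrK => /eqP.
by move/eqP; rewrite -subr_eq0 addrAC subrr add0r => /eqP.
Qed.

Lemma ptsum_homog (T : eqType) (e : T -> bool) b w (g : seq (seq T) -> U) :
  (forall P, partition_spec w P -> homog b (g P)) -> homog b (ptsum e w g).
Proof.
move=> gb; rewrite /ptsum big_seq; elim/big_ind: _ => [||P /partitions_spec Pw].
- exact: homog0.
- exact: homogD.
- by apply/homogZ/gb.
Qed.

End Homogeneous.

Section Multilinear.
Variables (R : fieldType) (U W : superSpace R) (m : seq U -> W).
Hypothesis m_lin : multilinear m.

Lemma multilinear0 u v : m (u ++ 0 :: v) = 0.
Proof.
by have := m_lin u v (-1) 0 0; rewrite scaler0 addr0 scaleN1r addNr.
Qed.

Lemma multilinearZ u v c x : m (u ++ (c *: x) :: v) = c *: m (u ++ x :: v).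
Proof. by have := m_lin u v c x 0; rewrite addr0 multilinear0 addr0. Qed.

Lemma multilinearD u v x y :
  m (u ++ (x + y) :: v) = m (u ++ x :: v) + m (u ++ y :: v).
Proof. by rewrite -[x in LHS]scale1r m_lin scale1r. Qed.

Lemma multilinear_head v : linear (fun x => m (x :: v)).
Proof. by move=> c x y; rewrite (m_lin [::]). Qed.

Definition head_map v : {linear U -> W} :=
  HB.pack (fun x => m (x :: v))
    (GRing.isLinear.Build R U W *:%R _ (multilinear_head v)).

Lemma multilinear_shsum (T : eqType) (e : T -> bool) w (g : seq T -> seq T ->
  U) v :
  m (shsum e w g :: v) = shsum e w (fun a b => m (g a b :: v)).
Proof. exact: (shsum_linear e (head_map v)). Qed.

Lemma multilinear_ptsum (T : eqType) (e : T -> bool) w (g : seq (seq T) ->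
  U) v :
  m (ptsum e w g :: v) = ptsum e w (fun P => m (g P :: v)).
Proof. exact: (ptsum_linear e (head_map v)). Qed.

End Multilinear.

(** * The transferred structure on words *)

Section Transfer.
Variables (R : fieldType) (U K : superSpace R) (m : seq U -> U).
Variables (i : {linear K -> U}) (p : {linear U -> K}) (s : {linear U -> U}).

(** [with_diff] over an arbitrary super space, so that parity reversion stays out of sight; for
    [U = Pi V] the two are convertible. *)
Definition add_diff (u : seq U) : U := if u is [:: x] then diff U x else m u.

Hypothesis m_small : forall u, (size u < 2)%N -> m u = 0.
Hypothesis m_lin : multilinear m.
Hypothesis m_sym : graded_symmetric m.
Hypothesis m_odd : has_parity m true.
Hypothesis m_rel : forall w : seq (bool * U), all (fun t => homog t.1 t.2) w ->
  shsum fst w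
    (fun a b => add_diff (add_diff (map snd a) :: map snd b)) = 0.
Hypothesis ips : strong_retract i p s.
Hypothesis K_diff : forall h, diff K h = 0.

Local Notation T := (bool * K)%type.
Local Notation e := (@fst bool K).
Implicit Types (w a b : seq T) (P : seq (seq T)).

(* A letter (b, h) stands for the part of h of parity b, so that no
   homogeneity assumption on h is needed. *)
Definition input w : U := if w is [:: t] then i (hcomp K t.1 t.2) else 0.

(** The number [n] is fuel: the one-block partition calls the function on [w] itself, and only
    [m_small] shows that this term vanishes. *)
Fixpoint transfer_rec n w : U :=
  if n is n'.+1 then
    input w - s (ptsum e w (fun P => m (map (transfer_rec n') P)))
  else 0.

Definition transfer w : U := transfer_rec (size w) w.

Definition transfer_m w : U := ptsum e w (fun P => m (map transfer P)).

Definition transfer_l w : K := p (transfer_m w).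

(** With fewer than two blocks both sides are 0, so the two functions need only agree on blocks that
    [size_block] shows to be shorter. *)
Lemma eq_m_map P (f g : seq T -> U) :
  ((1 < size P)%N -> {in P, f =1 g}) -> m (map f P) = m (map g P).
Proof.
case: (ltnP 1 (size P)) => [_ fg|P1 _].
  by congr m; apply/eq_in_map/fg.
by rewrite !m_small ?size_map.
Qed.

Lemma transfer_recE n w : (size w <= n)%N -> transfer_rec n w = transfer w.
Proof.
have [k] := ubnP (size w); elim: k n w => // k IH [|n] w; rewrite ltnS => wk wn.
  by rewrite /transfer; case: w wk wn.
rewrite /transfer; case: (posnP (size w)) => [/size0nil ->|w0].
  by rewrite /= ptsum_nil m_small // raddf0 subr0.
rewrite -(prednK w0) /=; congr (_ - s _); apply: eq_ptsum => P Pw.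
apply: eq_m_map => P1 B BP; have Bw := size_block Pw BP P1.
rewrite !IH //; try exact: leq_trans Bw wk.
  by rewrite -ltnS prednK.
by rewrite -ltnS (leq_trans Bw).
Qed.

Lemma transferE w : transfer w = input w - s (transfer_m w).
Proof.
rewrite -(transfer_recE (leqnSn _)) /=; congr (_ - s _).
apply: eq_ptsum => P Pw; apply: eq_m_map => P1 B BP.
by rewrite transfer_recE // ltnW // (size_block Pw BP P1).
Qed.

Lemma homog_m_map w P (f : seq T -> U) :
  (forall B, homog (par e B) (f B)) -> partition_spec w P ->
  homog (~~ par e w) (m (map f P)).
Proof.
move=> f_par /andP[_ /(par_perm e) <-]; rewrite par_flatten.
have := m_odd (e := map (par e) P) (u := map f P).
rewrite /= -[odd _]/(par id _) /par count_map; apply.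
by elim: P => //= B P ->; rewrite f_par.
Qed.

Lemma homog_transfer_rec n w : homog (par e w) (transfer_rec n w).
Proof.
elim: n w => [|n IH] w /=; first exact: homog0.
apply: homogD.
  case: w => [|t [|t' w]]; rewrite ?homog0 //= /homog /par /= addn0 oddb.
  by rewrite (retract_i_even ips) hcompK.
rewrite homogN // /homog; move: (retract_s_odd ips) => s_odd.
rewrite -[par e w]negbK s_odd; apply/eqP; congr (s _); apply/eqP.
by apply: ptsum_homog => P; apply: homog_m_map.
Qed.

Lemma homog_transfer w : homog (par e w) (transfer w).
Proof. exact: homog_transfer_rec. Qed.

Lemma homog_transfer_m w : homog (~~ par e w) (transfer_m w).
Proof. by apply: ptsum_homog => P; apply/homog_m_map/homog_transfer. Qed.

Lemma homog_transfer_l w : homog (~~ par e w) (transfer_l w).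
Proof.
rewrite /homog (retract_p_even ips); apply/eqP; congr (p _).
exact/eqP/homog_transfer_m.
Qed.

Lemma ptsum_m_swaps n x y (f : seq T -> U) :
  (forall B, homog (par e B) (f B)) -> swaps e n x y f ->
  swaps e n x y (fun w => ptsum e w (fun P => m (map f P))).
Proof.
move=> f_par f_swaps; apply: ptsum_swaps => [P Q u v uv|P Q B C].
  by rewrite !map_cat /= f_swaps // multilinearZ.
by rewrite !map_cat /=; apply: m_sym.
Qed.

Lemma transfer_rec_swaps k n x y : swaps e n x y (transfer_rec k).
Proof.
elim: k => [|k IH] u v uv /=; first by rewrite scaler0.
have input0 z t : input (u ++ z :: t :: v) = 0 by case: u {uv} => [|? []].
rewrite !input0 !sub0r scalerN -linearZ /=; congr (- s _).
exact: (ptsum_m_swaps (homog_transfer_rec k) IH uv).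
Qed.

Lemma transfer_swaps n x y : swaps e n x y transfer.
Proof.
move=> u v uv; rewrite /transfer (transfer_rec_swaps _ x y uv).
by rewrite !size_cat.
Qed.

Lemma transfer_l_swaps n x y u v : (size u + size v <= n)%N ->
  transfer_l (u ++ x :: y :: v) =
  (-1) ^+ (e x && e y) *: transfer_l (u ++ y :: x :: v).
Proof.
move=> uv; rewrite -linearZ /=; congr (p _).
exact: (ptsum_m_swaps homog_transfer (@transfer_swaps n x y) uv).
Qed.

Lemma ptsum_m_combines n c x y z (f : seq T -> U) :
  e x = e z -> e y = e z -> combines n c x y z f ->
  combines n c x y z (fun w => ptsum e w (fun P => m (map f P))).
Proof.
move=> xz yz f_lin; apply: ptsum_combines => // P Q u v uv.
by rewrite !map_cat /= f_lin.
Qed.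

Lemma transfer_rec_combines k n c (b : bool) (h h' : K) :
  combines n c (b, h) (b, h') (b, c *: h + h') (transfer_rec k).
Proof.
elim: k => [|k IH] u v uv /=; first by rewrite scaler0 addr0.
have -> : input (u ++ (b, c *: h + h') :: v) =
    c *: input (u ++ (b, h) :: v) + input (u ++ (b, h') :: v).
  case: u {uv} => [|? []] /=; rewrite ?scaler0 ?addr0 //.
  by case: v => /= [|_ _]; rewrite ?scaler0 ?addr0 // !linearP.
rewrite (ptsum_m_combines (c := c) (x := (b, h)) (y := (b, h')) _ _ IH) //.
by rewrite linearP /= scalerBr opprD addrACA.
Qed.

Lemma transfer_combines n c (b : bool) (h h' : K) :
  combines n c (b, h) (b, h') (b, c *: h + h') transfer.
Proof.
move=> u v uv; rewrite /transfer (transfer_rec_combines _ c b h h' uv).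
by rewrite !size_cat.
Qed.

Lemma transfer_l_combines n c (b : bool) (h h' : K) u v :
  (size u + size v <= n)%N ->
  transfer_l (u ++ (b, c *: h + h') :: v) =
  c *: transfer_l (u ++ (b, h) :: v) + transfer_l (u ++ (b, h') :: v).
Proof.
move=> uv; rewrite -linearP /=; congr (p _).
exact: (ptsum_m_combines _ _ (@transfer_combines n c b h h') uv).
Qed.

Lemma transfer_l_small w : (size w < 2)%N -> transfer_l w = 0.
Proof.
case: w => [|t [|//]] _; first by rewrite /transfer_l /transfer_m ptsum_nil
  m_small ?raddf0.
by rewrite /transfer_l /transfer_m ptsum_cons shsum_nil ptsum_nil m_small //
  raddf0.
Qed.

Lemma transfer1 t : transfer [:: t] = i (hcomp K t.1 t.2).
Proof.
rewrite transferE /transfer_m ptsum_cons shsum_nil ptsum_nil m_small //.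
by rewrite raddf0 subr0.
Qed.

(** As l is odd, its value has the parity opposite to that of [a]; with this tag it can be a letter
    of a new word. *)
Definition tagged_l a : T := (~~ par e a, transfer_l a).

(* The derivative m'(f(h))[Y(h)]. *)
Definition deriv_m (Y : seq T -> U) w : U :=
  shsum e w (fun a b => ptsum e b (fun P => m (Y a :: map transfer P))).

Lemma deriv_mB (Y Z : seq T -> U) w :
  deriv_m (fun a => Y a - Z a) w = deriv_m Y w - deriv_m Z w.
Proof.
rewrite -shsumN -shsumD; apply: eq_shsum => a b _.
rewrite -[- ptsum _ _ _]scaleN1r -ptsumZ -ptsumD; apply: eq_ptsum => P _.
by rewrite addrC -scaleN1r (multilinear_head m_lin) addrC.
Qed.

(* f'(h)[l(h)] *)
Definition morphism_lhs w : U :=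
  shsum e w (fun a b => transfer (tagged_l a :: b)).

(** The chain rule: the block containing the inserted letter is the factor that gets differentiated,
    and [shsumA] collects the terms of f'(h)[l(h)] there. *)
Lemma shsum_transfer_m w :
  shsum e w (fun a b => transfer_m (tagged_l a :: b)) = deriv_m morphism_lhs w.
Proof.
rewrite /transfer_m; under eq_shsum do rewrite ptsum_cons.
rewrite -shsumA; apply: eq_shsum => c b _.
rewrite -ptsum_shsum; apply: eq_ptsum => P _.
by rewrite multilinear_shsum.
Qed.

(* Q(f(h)) *)
Definition morphism_rhs w : U := ptsum e w (fun P => add_diff (map transfer P)).

Lemma add_diff_cons x u :
  add_diff (x :: u) = m (x :: u) + (if u is [::] then diff U x else 0).
Proof. by case: u => [|y u] /=; rewrite ?addr0 // m_small // add0r. Qed.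

Lemma add_diff_linear : multilinear add_diff.
Proof.
move=> [|x0 [|x1 u]] v c x y; rewrite ?cat_cons ?cat0s !add_diff_cons /=.
- rewrite (multilinear_head m_lin) scalerDr -!addrA; congr (_ + _).
  case: v => [|z v]; first by rewrite linearP addrCA.
  by rewrite scaler0 add0r.
- by rewrite !addr0; apply: (m_lin [:: x0]).
- by rewrite !addr0; apply: (m_lin [:: x0, x1 & u]).
Qed.

Lemma transfer_nil : transfer [::] = 0.
Proof. by []. Qed.

Lemma morphism_rhs_diff w : morphism_rhs w = diff U (transfer w) + transfer_m w.
Proof.
transitivity (ptsum e w (fun P => (if P is [:: B] then diff U (transfer B) else
  0)
    + m (map transfer P))).
  apply: eq_ptsum => -[_|B P _]; first by rewrite /= add0r.
  by rewrite map_cons add_diff_cons addrC; case: P.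
rewrite ptsumD; congr (_ + _).
rewrite (ptsum_if_single e w (fun B => diff U (transfer B))).
by case: w => //; rewrite transfer_nil raddf0.
Qed.

(* The Maurer-Cartan equation at f(h). *)
Lemma diff_transfer_m w : diff U (transfer_m w) + deriv_m morphism_rhs w = 0.
Proof.
have: ptsum e w (fun P => shsum (par e) P (fun P1 P2 =>
    add_diff (add_diff (map transfer P1) :: map transfer P2))) = 0.
  rewrite -[RHS](ptsum0 e U w); apply: eq_ptsum => P _.
  (* The relation is applied to a word whose letters are the blocks, each standing for its value
     under [transfer]. *)
  pose h B := (par e B, transfer B).
  rewrite -[RHS](m_rel (w := map h P)); last first.
    by apply/allP => _ /mapP[B _ ->]; apply: homog_transfer.
  rewrite (shsum_map (e := par e)) //; apply: eq_shsum => P1 P2 _.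
  by rewrite -!map_comp.
rewrite ptsum_shsum_par => <-.
(* The outer differential acts only when nothing remains beside Q(f(h)), and there d Q(f(h)) = d
   m(f(h)) because d d = 0. *)
transitivity (shsum e w (fun a b =>
    (if b is [::] then diff U (morphism_rhs a) else 0) +
    ptsum e b (fun P => m (morphism_rhs a :: map transfer P)))).
  rewrite shsumD; congr (_ + _).
  rewrite (shsum_right_nil e w (fun a => diff U (morphism_rhs a))).
  by rewrite morphism_rhs_diff raddfD /= diffK add0r.
apply: eq_shsum => a b _; rewrite ptsum_ptsum.
transitivity (ptsum e b (fun P => add_diff (morphism_rhs a :: map transfer P))).
  rewrite -(ptsum_if_nil e) -ptsumD; apply: eq_ptsum => P _.
  by rewrite add_diff_cons addrC; case: P.
by apply: eq_ptsum => P _; rewrite (multilinear_ptsum add_diff_linear).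
Qed.

Lemma input_tagged_l a b :
  input (tagged_l a :: b) = if b is [::] then i (transfer_l a) else 0.
Proof. by case: b => //; rewrite /= (eqP (homog_transfer_l a)). Qed.

Lemma morphism_lhsE w : morphism_lhs w =
  i (transfer_l w) - s (deriv_m morphism_lhs w).
Proof.
rewrite -shsum_transfer_m (shsum_linear e s) -shsumN.
rewrite -(shsum_right_nil e w (fun a => i (transfer_l a))) -shsumD.
by apply: eq_shsum => a b _; rewrite transferE input_tagged_l.
Qed.

Lemma diff_input w : diff U (input w) = 0.
Proof.
case: w => [|t [|t' w]]; rewrite /= ?raddf0 //.
by rewrite -(retract_i_chain ips) K_diff raddf0.
Qed.

(** Since [d i] vanishes, d f + m(f) = (1 - d s) m(f) = (i p + s d) m(f), and the Maurer-Cartan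
    equation turns d m(f) into - m'(f)[Q(f)]. Both sides of the morphism relation thus solve one
    affine equation. *)
Lemma morphism_rhsE w : morphism_rhs w =
  i (transfer_l w) - s (deriv_m morphism_rhs w).
Proof.
have := diff_transfer_m w => /(canRL (addKr _)); rewrite addr0 => ->.
rewrite morphism_rhs_diff transferE raddfB /= diff_input sub0r raddfN opprK /=.
apply: (addrI (diff U (s (transfer_m w)))).
by rewrite addNKr addrCA (retract_ds ips) addrC subrK.
Qed.

Lemma morphism_sidesE w : morphism_lhs w = morphism_rhs w.
Proof.
have [n] := ubnP (size w); elim: n w => // n IH w; rewrite ltnS => wn.
apply/eqP; rewrite -subr_eq0 morphism_lhsE morphism_rhsE opprB addrC addrA subrK
  -raddfB /= -deriv_mB.
suff ->: deriv_m (fun a => morphism_rhs a - morphism_lhs a) w =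
  0 by rewrite raddf0.
rewrite -[RHS](shsum0 e U w); apply: eq_shsum => a b /perm_size.
(* An empty [b] leaves [m] with a single argument; a nonempty one makes [a] shorter than [w], so the
   induction hypothesis applies. *)
rewrite size_cat => ab; case: b ab => [|t b] ab;
  first by rewrite ptsum_nil m_small.
rewrite -[RHS](ptsum0 e U (t :: b)); apply: eq_ptsum => P _.
rewrite IH ?subrr ?(multilinear0 m_lin [::]) //.
by rewrite (leq_trans _ wn) // -ab /= addnS ltnS leq_addr.
Qed.

Lemma transfer_l_relation w :
  shsum e w (fun a b => transfer_l (tagged_l a :: b)) = 0.
Proof.
rewrite -(shsum_linear e p) shsum_transfer_m.
have ->: deriv_m morphism_lhs w = deriv_m morphism_rhs w.
  apply: eq_shsum => a b _; apply: eq_ptsum => P _.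
  by rewrite morphism_sidesE.
have := diff_transfer_m w => /(canRL (addKr _)) ->.
by rewrite addr0 raddfN /= (retract_p_chain ips) K_diff oppr0.
Qed.

End Transfer.

(** * Subsets and set partitions of the inputs *)

Lemma uniq_map_inj (S T : eqType) (f : S -> T) (s : seq S) :
  uniq (map f s) -> {in s &, injective f}.
Proof.
elim: s => //= x s IH /andP[xs s_uniq] y z.
rewrite !inE => /predU1P[->|ys] /predU1P[->|zs] // fyz; last exact: IH.
  by rewrite fyz map_f in xs.
by rewrite -fyz map_f in xs.
Qed.

Section Unshuffles.
Variables (T : eqType) (e : T -> bool).

Lemma unshuffles_subseq w z :
  z \in unshuffles e w -> subseq z.1.2 w /\ subseq z.2 w.
Proof.
elim: w z => [|x w IH] z /=; first by rewrite inE => /eqP->.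
rewrite mem_cat => /orP[] /mapP[y /IH[ya yb] ->] /=; split;
  rewrite ?eqxx //; exact: subseq_trans (subseq_cons _ _).
Qed.

(** Every subset of the letters is the left half of some unshuffle: surjectivity in the passage to
    sums over subsets. *)
Lemma unshuffles_filter (A : pred T) w :
  ([seq x <- w | A x], [seq x <- w | ~~ A x]) \in
    [seq (z.1.2, z.2) | z <- unshuffles e w].
Proof.
elim: w => [|x w IH] //=; rewrite map_cat mem_cat -!map_comp.
by have /mapP[z zw [-> ->]] := IH; apply/orP; case: (A x) => /=; [left|right];
  apply/mapP; exists z.
Qed.

(** Injectivity in the same passage: without repeated letters the left half determines the
    unshuffle. *)
Lemma unshuffles_uniq w : uniq w -> uniq [seq z.1.2 | z <- unshuffles e w].
Proof.
elim: w => //= x w IH /andP[xw /IH w_uniq]; rewrite map_cat -!map_comp cat_uniq.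
rewrite (map_comp (cons x)) map_inj_uniq ?w_uniq => [|a b []//].
rewrite andbT; apply/hasPn => _ /mapP[z zw ->] /=.
apply: contra xw => /mapP[a _ za].
by have [/mem_subseq + _] := unshuffles_subseq zw; apply; rewrite za mem_head.
Qed.

Lemma partitions_cons_snd x w :
  [seq P.2 | P <- partitions e (x :: w)] =
  [seq (x :: z.1.2) :: L | z <- unshuffles e w,
    L <- [seq P.2 | P <- partitions e z.2]].
Proof.
rewrite partitions_cons map_flatten -map_comp; congr flatten.
by apply: eq_map => z /=; rewrite -!map_comp.
Qed.

Lemma partitions_uniq w : uniq w -> uniq [seq P.2 | P <- partitions e w].
Proof.
have [k] := ubnP (size w); elim: k w => // k IH [|x w] //= wk /andP[xw w_uniq].
rewrite partitions_cons_snd.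
apply: allpairs_uniq_dep => [|z zw|[z L] [z' L']].
- exact: map_uniq (unshuffles_uniq w_uniq).
- have [_ zw2] := unshuffles_subseq zw; apply: IH;
  last exact: subseq_uniq w_uniq.
  by rewrite (leq_ltn_trans (size_subseq zw2)).
move=> /allpairsPdep[z1 [L1 [zw L1z [-> ->]]]].
move=> /allpairsPdep[z2 [L2 [zw' L2z [-> ->]]]] /= [z12 L12].
by rewrite (uniq_map_inj (unshuffles_uniq w_uniq) zw zw' z12) L12.
Qed.
End Unshuffles.

(** * Koszul signs as counts of odd inversions *)

Section KoszulSigns.
Variables (n : nat) (e : 'I_n -> bool).
Implicit Types (u v w : seq 'I_n) (P L : seq (seq 'I_n)).

(** The part of the Koszul exponent due to pairs with one letter in each word. Unlike [koszul], it
    does not depend on the order within either word. *)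
Definition crossings u v : bool :=
  odd (\sum_(j <- u) \sum_(k <- v) [&& (k < j)%N, e j & e k]).

Lemma perm_crossings u u' v v' :
  perm_eq u u' -> perm_eq v v' -> crossings u v = crossings u' v'.
Proof.
move=> uu' vv'; rewrite /crossings (perm_big _ uu') /=; congr odd.
by apply: eq_bigr => j _; rewrite (perm_big _ vv').
Qed.

Lemma crossings_catl u u' v :
  crossings (u ++ u') v = crossings u v (+) crossings u' v.
Proof. by rewrite /crossings big_cat oddD. Qed.

Lemma crossings_catr u v v' :
  crossings u (v ++ v') = crossings u v (+) crossings u v'.
Proof.
rewrite /crossings -oddD -big_split; congr odd.
by apply: eq_bigr => j _; rewrite big_cat.
Qed.

Lemma koszul_cons j w : koszul e (j :: w) = crossings [:: j] w (+) koszul e w.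
Proof.
rewrite /= /crossings big_seq1; congr (_ (+) _).
case: (e j) => /=; last by rewrite big1 // => k _; rewrite andbF.
by congr odd; elim: w => [|k w IH]; rewrite ?big_nil // big_cons -IH.
Qed.

Lemma koszul_cat u v :
  koszul e (u ++ v) = koszul e u (+) koszul e v (+) crossings u v.
Proof.
elim: u => [|j u IH]; first by rewrite /crossings big_nil addbF.
rewrite cat_cons !koszul_cons IH crossings_catr.
rewrite -[j :: u]cat1s crossings_catl !addbA.
by do 4 case: (crossings _ _) => //=; case: (koszul e u); case: (koszul e v).
Qed.

Lemma crossings_all_gt (j : 'I_n) w : all (fun k : 'I_n => j < k)%N w ->
  crossings [:: j] w = false.
Proof.
move=> /allP jw; rewrite /crossings big_seq1 big_seq big1 // => k /jw jk.
by rewrite ltnNge ltnW.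
Qed.

Lemma crossings_all_lt (j : 'I_n) w :
  all (fun k : 'I_n => j < k)%N w -> crossings w [:: j] = e j && par e w.
Proof.
elim: w => [|k w IH] /=; first by rewrite /crossings big_nil andbF.
case/andP=> jk /IH; rewrite -[k :: w]cat1s crossings_catl => ->;
  rewrite par_cons.
rewrite /crossings !big_seq1 jk /= oddb.
by case: (e j); case: (e k).
Qed.

(** Two distinct letters are inverted in exactly one of the two orders, so together the orders count
    every pair of odd letters once. *)
Lemma crossingsC u v : uniq (u ++ v) ->
  crossings u v (+) crossings v u = par e u && par e v.
Proof.
elim: u => [|j u IH] /=; first by rewrite /crossings big_nil big1 // => k;
  rewrite big_nil.
rewrite mem_cat negb_or -andbA => /and3P[_ jv /IH {}IH].
rewrite -[j :: u]cat1s crossings_catl crossings_catr par_cat andb_addl -IH.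
suff -> : par e [:: j] && par e v = crossings [:: j] v (+) crossings v [:: j].
  by do 4 case: (crossings _ _).
elim: v jv {IH} => [|k v IH] /=.
  by rewrite /crossings big_seq1 !big_nil andbF.
rewrite inE negb_or => /andP[jk /IH {}IH].
rewrite -[k :: v]cat1s crossings_catl crossings_catr par_cat andb_addr IH.
suff -> : par e [:: j] && par e [:: k] =
  crossings [:: j] [:: k] (+) crossings [:: k] [:: j].
  by do 4 case: (crossings _ _).
rewrite /crossings !big_seq1 /par /= !addn0 !oddb.
by case: (ltngtP k j) (jk) => [||/val_inj ->]; rewrite ?eqxx //=; case: (e j);
  case: (e k).
Qed.

Definition ord_lt : rel 'I_n := relpre val ltn.

Lemma ord_lt_trans : transitive ord_lt.
Proof. by move=> j k l; apply: ltn_trans. Qed.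

Lemma ord_lt_irr : irreflexive ord_lt.
Proof. by move=> j; apply: ltnn. Qed.

Lemma sorted_enum (A : {pred 'I_n}) : sorted ord_lt (enum A).
Proof.
rewrite /enum_mem -enumT sorted_filter //; first exact: ord_lt_trans.
by rewrite -sorted_map val_enum_ord iota_ltn_sorted.
Qed.

Lemma sorted_uniq_ord w : sorted ord_lt w -> uniq w.
Proof. exact: sorted_uniq ord_lt_trans ord_lt_irr _. Qed.

Lemma sorted_cons_all j w :
  sorted ord_lt (j :: w) = all (ord_lt j) w && sorted ord_lt w.
Proof. by rewrite /= path_sortedE //; apply: ord_lt_trans. Qed.

Lemma eq_sorted_ord u v :
  sorted ord_lt u -> sorted ord_lt v -> u =i v -> u = v.
Proof. exact: irr_sorted_eq ord_lt_trans ord_lt_irr _ _. Qed.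

Lemma koszul_sorted w : sorted ord_lt w -> koszul e w = false.
Proof.
elim: w => // j w IH; rewrite sorted_cons_all => /andP[jw /IH w0].
by rewrite koszul_cons w0 crossings_all_gt.
Qed.

(** In a sorted word the head letter is the least, so the odd letters it passes when sent to the
    right are precisely its inversions. *)
Lemma unshuffles_sign w z : sorted ord_lt w -> z \in unshuffles e w ->
  z.1.1 = koszul e (z.1.2 ++ z.2).
Proof.
elim: w z => [|x w IH] z; first by rewrite inE => _ /eqP->.
rewrite sorted_cons_all mem_cat => /andP[xw /IH {}IH].
have x_lt z' : z' \in unshuffles e w ->
    all (ord_lt x) z'.1.2 /\ all (ord_lt x) z'.2.
  move=> /unshuffles_perm /perm_all; rewrite /= => /(_ (ord_lt x)).
  by rewrite all_cat xw => /andP.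
case/orP=> /mapP[z' zw ->] /=; have [xa xb] := x_lt _ zw.
  by rewrite -/(koszul e (x :: z'.1.2 ++ z'.2)) koszul_cons crossings_all_gt
    ?all_cat ?xa // -IH.
rewrite IH // !koszul_cat koszul_cons crossings_all_gt //=.
rewrite -[x :: z'.2]cat1s crossings_catr crossings_all_lt //.
by do 2 case: (crossings _ _) => //; case: (koszul e z'.1.2);
  case: (koszul e z'.2); case: (e x && _).
Qed.

Lemma partitions_sign w (P : bool * seq (seq 'I_n)) : sorted ord_lt w ->
  P \in partitions e w ->
  P.1 = koszul e (flatten P.2).
Proof.
have [k] := ubnP (size w); elim: k w P => // k IH [|x w] P.
  by rewrite inE => _ _ /eqP->.
rewrite ltnS sorted_cons_all => wk /andP[xw w_lt]; rewrite partitions_cons.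
case/flattenP=> _ /mapP[z zw ->] /mapP[Q Qz ->].
have [z1w z2w] := unshuffles_subseq zw.
have z2_lt : sorted ord_lt z.2 := subseq_sorted ord_lt_trans z2w w_lt.
have z1_lt : sorted ord_lt z.1.2 := subseq_sorted ord_lt_trans z1w w_lt.
have zQ : perm_eq (flatten Q.2) z.2 by have /andP[] := partitions_spec Qz.
rewrite [flatten _]/= koszul_cons crossings_all_gt; last first.
  rewrite (perm_all _ (s2 := w)) //; apply: perm_trans (unshuffles_perm zw).
  by rewrite perm_cat2l.
rewrite [LHS]/= (unshuffles_sign w_lt zw) (IH _ _ _ z2_lt Qz); last first.
  by rewrite (leq_ltn_trans (size_subseq z2w)).
(* The sorted word [z.2] has no sign of its own, and its crossings with the first block survive its
   rearrangement into blocks. *)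
rewrite !koszul_cat (koszul_sorted z2_lt) (perm_crossings (perm_refl _) zQ) /=.
by rewrite addbF addbAC.
Qed.

Lemma shsum_sorted (R : fieldType) (M : lmodType R) w (g : seq 'I_n ->
  seq 'I_n -> M) :
  sorted ord_lt w ->
  shsum e w g =
  \sum_(z <- unshuffles e w) (-1) ^+ koszul e (z.1.2 ++ z.2) *: g z.1.2 z.2.
Proof.
by move=> w_lt; apply: eq_big_seq => z /(unshuffles_sign w_lt) ->.
Qed.

Lemma ptsum_sorted (R : fieldType) (M : lmodType R) w (g : seq (seq 'I_n) ->
  M) :
  sorted ord_lt w ->
  ptsum e w g =
  \sum_(P <- [seq Q.2 | Q <- partitions e w]) (-1) ^+ koszul e (flatten P) *: g
    P.
Proof.
by move=> w_lt; rewrite big_map; apply: eq_big_seq =>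
  P /(partitions_sign w_lt) ->.
Qed.

Lemma enum_set_sorted w : sorted ord_lt w -> enum [set j in w] = w.
Proof.
move=> w_lt; apply: eq_sorted_ord => //; first exact: sorted_enum.
by move=> j; rewrite mem_enum inE.
Qed.

(** An unshuffle of an increasing word has increasing halves, so it is recovered from the set of
    letters of its left half. *)
Lemma shsum_enum (R : fieldType) (M : lmodType R) (g : seq 'I_n -> seq 'I_n ->
  M) :
  shsum e (enum 'I_n) g =
  \sum_(A : {set 'I_n})
    (-1) ^+ koszul e (enum A ++ enum (~: A)) *: g (enum A) (enum (~: A)).
Proof.
have all_lt := sorted_enum 'I_n.
pose h (z : bool * seq 'I_n * seq 'I_n) := [set j in z.1.2].
have hE z : z \in unshuffles e (enum 'I_n) ->
    enum (h z) = z.1.2 /\ enum (~: h z) = z.2.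
  move=> zn; have [z1 z2] := unshuffles_subseq zn.
  have z1_lt := subseq_sorted ord_lt_trans z1 all_lt.
  have z2_lt := subseq_sorted ord_lt_trans z2 all_lt.
  split; first exact: enum_set_sorted.
  apply: eq_sorted_ord => // [|j]; first exact: sorted_enum.
  have zj := perm_mem (unshuffles_perm zn) j.
  have := sorted_uniq_ord all_lt; rewrite -(perm_uniq (unshuffles_perm zn)).
  rewrite cat_uniq => /and3P[_ /hasPn zz _].
  rewrite mem_enum !inE; move: zj; rewrite mem_cat mem_enum inE.
  by case: (boolP (j \in z.2)) => [/zz /negPf -> //|_]; rewrite orbF => ->.
rewrite (shsum_sorted _ all_lt).
have: perm_eq [seq h z | z <- unshuffles e (enum 'I_n)] (index_enum {set 'I_n}).
  apply: uniq_perm; last 2 first.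
  - exact: index_enum_uniq.
  - move=> A; rewrite mem_index_enum; apply/mapP.
    have /mapP[z zn [Az _]] := unshuffles_filter e (mem A) (enum 'I_n).
    exists z => //; apply/setP=> j; rewrite inE -Az mem_filter mem_enum.
    by rewrite andbT.
  rewrite map_inj_in_uniq; first exact: map_uniq (unshuffles_uniq e
    (sorted_uniq_ord all_lt)).
  move=> y z yn zn /(congr1 (fun A : {set 'I_n} => enum A)).
  rewrite (hE _ yn).1 (hE _ zn).1.
  exact: (uniq_map_inj (unshuffles_uniq e (sorted_uniq_ord all_lt)) yn zn).
move=> hn; rewrite -(perm_big _ hn) big_map /=.
by apply: eq_big_seq => z zn; rewrite (hE _ zn).1 (hE _ zn).2.
Qed.
End KoszulSigns.
Arguments ord_lt {n}.
Arguments ord_lt_trans {n}.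

(** Adjacent transpositions connect all permutations of a list. [Q] is the condition that makes a
    swap legitimate; it will say that no letter repeats among the blocks. *)
Lemma perm_swap_invariant (A : eqType) (V : Type) (Q : seq A -> Prop)
    (F : seq A -> V) :
  (forall s t, perm_eq s t -> Q s -> Q t) ->
  (forall u v x y, Q (u ++ x :: y :: v) ->
     F (u ++ x :: y :: v) = F (u ++ y :: x :: v)) ->
  forall s t, perm_eq s t -> Q s -> F s = F t.
Proof.
move=> Qperm Fswap s t st Qs.
have Fmove x u v w : Q (u ++ x :: v ++ w) ->
  F (u ++ x :: v ++ w) = F (u ++ v ++ x :: w).
  elim: v u => // y v IH u Qu; rewrite /= Fswap // -cat_rcons IH ?cat_rcons //.
  by apply: Qperm Qu; rewrite perm_cat2l -(perm_catCA [:: y] [:: x]).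
suff Fcat u : Q (u ++ s) -> F (u ++ s) = F (u ++ t) by apply: (Fcat [::]).
elim: s u t st {Qs} => [|x s IH] u t st Qu.
  by move: st; rewrite perm_sym => /perm_nilP ->.
have xt : x \in t by rewrite -(perm_mem st) mem_head.
case: (path.splitPr xt) st => t1 t2 st.
have {}st : perm_eq s (t1 ++ t2).
  by rewrite -(perm_cons x) (perm_trans st) // -(perm_catCA [:: x] t1 t2).
rewrite -cat_rcons (IH (rcons u x) (t1 ++ t2)) ?cat_rcons // Fmove //.
by apply: Qperm Qu; rewrite perm_cat2l perm_cons.
Qed.

Lemma perm_eq_flatten (A : eqType) (P Q : seq (seq A)) :
  perm_eq P Q -> perm_eq (flatten P) (flatten Q).
Proof.
move=> PQ; apply/permP => a; rewrite !count_flatten.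
exact/perm_sumn/perm_map.
Qed.

(** * Set partitions listed by least element *)

Section CanonicalPartitions.
Variable n : nat.
Implicit Types (u v w : seq 'I_n) (P L : seq (seq 'I_n)).

(** The same fold as in [least_leaf], with default [n] above all letters, so that the order of
    subtrees becomes the order of blocks. *)
Definition least w : nat := foldr minn n (map val w).

Lemma least_le w j : j \in w -> (least w <= j)%N.
Proof.
elim: w => //= k w IH; rewrite inE /least /= geq_min => /predU1P[->|/IH ->].
  by rewrite leqnn.
by rewrite orbT.
Qed.

Lemma least_ge w k : (k <= n)%N -> (forall j, j \in w -> k <= j)%N ->
  (k <= least w)%N.
Proof.
move=> kn; elim: w => //= j w IH kw; rewrite /least /= leq_min kw ?mem_head //=.
by apply: IH => l lw; rewrite kw // inE lw orbT.
Qed.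

Lemma least_max w : (least w <= n)%N.
Proof. by elim: w => //= j w IH; rewrite /least /= geq_min IH orbT. Qed.

Lemma least_sub u v : {subset v <= u} -> (least u <= least v)%N.
Proof.
move=> vu; apply: least_ge => [|j /vu]; [exact: least_max | exact: least_le].
Qed.

Lemma eq_least u v : u =i v -> least u = least v.
Proof.
by move=> uv; apply/eqP; rewrite eqn_leq !least_sub // => j; rewrite uv.
Qed.

Lemma least_sorted (j : 'I_n) w : sorted ord_lt (j :: w) -> least (j :: w) = j.
Proof.
rewrite sorted_cons_all => /andP[/allP jw _]; apply/eqP; rewrite eqn_leq.
rewrite least_le ?mem_head //=; apply: least_ge => [|k].
  exact/ltnW/ltn_ord.
by rewrite inE => /predU1P[->//|/jw/ltnW].
Qed.

Lemma least_mem w : w != [::] -> exists2 j, j \in w & least w = j.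
Proof.
elim: w => // j [|k w] IH _.
  by exists j; rewrite ?mem_head // least_sorted.
have [//|l lw lE] := IH; rewrite /least /= -/(least (k :: w)) in lE *.
have -> : minn j (minn k (foldr minn n [seq val i | i <- w])) =
  minn j l by rewrite -lE.
case: (leqP j l) => _; [exists j|exists l]; rewrite ?mem_head //.
by rewrite inE lw orbT.
Qed.

(* Each set partition of the letters of w has exactly one such listing. *)
Definition canonical_blocks w P := [&& all (fun B =>
  B != [::]) P, all (sorted ord_lt) P,
  sorted ltn (map least P) & perm_eq (flatten P) w].

Variable e : 'I_n -> bool.

Lemma partitions_canonical w P : sorted ord_lt w ->
  P \in [seq Q.2 | Q <- partitions e w] -> canonical_blocks w P.
Proof.
have [k] := ubnP (size w); elim: k w P => // k IH [|x w] P.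
  by rewrite inE => _ _ /eqP->.
rewrite ltnS => wk w_lt Pw.
have /mapP[P' /partitions_spec /andP[P0 Pflat] PE] := Pw;
  rewrite -PE in P0 Pflat.
move: (w_lt); rewrite sorted_cons_all => /andP[/allP xw w_lt'].
move: Pw P0 Pflat; rewrite partitions_cons_snd =>
  /allpairsPdep[z [L [zw Lz ->]]].
have [z1w z2w] := unshuffles_subseq zw.
have /and4P[L0 L1 L2 L3] := IH z.2 L
  (leq_ltn_trans (size_subseq z2w) wk) (subseq_sorted ord_lt_trans z2w w_lt')
    Lz.
move=> P0 Pflat; rewrite /canonical_blocks P0 Pflat /= L1.
have -> : path ord_lt x z.1.2.
  have /= := subseq_sorted (s1 := x :: z.1.2) ord_lt_trans _ w_lt.
  by rewrite eqxx => /(_ z1w).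
rewrite path_sortedE; last exact: ltn_trans.
rewrite L2 !andbT /=; apply/allP => _ /mapP[B BL ->].
have [j jB ->] := least_mem (allP L0 _ BL).
apply: leq_ltn_trans (least_le (mem_head _ _)) _.
apply/xw/(mem_subseq z2w); rewrite -(perm_mem L3).
by apply/flattenP; exists B.
Qed.

Lemma canonical_partitions w P : sorted ord_lt w ->
  canonical_blocks w P -> P \in [seq Q.2 | Q <- partitions e w].
Proof.
elim: P w => [|B L IH] w w_lt /and4P[P0 P1 P2 Pw].
  by move: Pw; rewrite perm_sym => /perm_nilP ->; rewrite inE.
case: w w_lt Pw => [|x w] w_lt Pw; first by case: B P0 P1 P2 Pw =>
  // ? ? _ _ _ /perm_size.
case: B P0 P1 P2 Pw => // y a P0 P1 P2 Pw.
have ya : sorted ord_lt (y :: a) by case/andP: P1.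
have L1 : all (sorted ord_lt) L by case/andP: P1.
have Py : least (y :: a) = y by apply: least_sorted.
(* Both are the least letter: [x] because [w] is sorted, [y] because the blocks are sorted and
   ordered by their least letters. *)
have xy : x = y.
  apply: val_inj; rewrite /= -Py -(least_sorted w_lt) -(eq_least (perm_mem Pw)).
  rewrite -[flatten _]/((y :: a) ++ flatten L).
  apply/eqP; rewrite eqn_leq least_sub => [|j ja]; last by rewrite mem_cat ja.
  rewrite andTb; apply: least_ge => [|j]; first exact: least_max.
  rewrite mem_cat => /orP[ja|/flattenP[C CL jC]]; first exact: least_le.
  move: P2; rewrite /= path_sortedE; last exact: ltn_trans.
  case/andP=> /allP /(_ (least C)); rewrite map_f // => /(_ isT) yC _.
  exact/(leq_trans (ltnW yC))/least_le.
subst y; rewrite partitions_cons_snd.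
have {}Pw : perm_eq (a ++ flatten L) w by rewrite -(perm_cons x).
move: w_lt; rewrite sorted_cons_all => /andP[_ w_lt].
have /mapP[z zw [az bz]] := unshuffles_filter e (mem a) w.
have {}az : z.1.2 = a.
  rewrite -az; apply: eq_sorted_ord => [||j].
  - exact: sorted_filter ord_lt_trans _ _ w_lt.
  - by move: ya; rewrite sorted_cons_all => /andP[].
  rewrite mem_filter /=; case ja: (j \in a) => //=.
  by rewrite -(perm_mem Pw) mem_cat ja.
apply/allpairsPdep; exists z, L; rewrite az; split=> //.
apply: IH; first by rewrite -bz; apply: sorted_filter ord_lt_trans _ _ w_lt.
have L0 : all (fun B => B != [::]) L by case/andP: P0.
rewrite /canonical_blocks L0 L1 (path_sorted P2) /=.
rewrite -(perm_cat2l a) (perm_trans Pw) // perm_sym -{1}az.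
exact: unshuffles_perm zw.
Qed.

End CanonicalPartitions.

Lemma uniq_flatten_inj (A : eqType) (L : seq (seq A)) B C j :
  uniq (flatten L) -> B \in L -> C \in L -> j \in B -> j \in C -> B = C.
Proof.
elim: L => //= D L IH; rewrite cat_uniq => /and3P[_ /hasPn DL /IH {}IH].
have no E : E \in L -> j \in E -> j \notin D.
  by move=> EL jE; apply: DL; apply/flattenP; exists E.
rewrite !inE => /predU1P[->|BL] /predU1P[->|CL] jB jC //; last exact: IH.
  by rewrite (negPf (no _ CL jC)) in jB.
by rewrite (negPf (no _ BL jB)) in jC.
Qed.

Section PartitionSums.
Variables (n : nat) (e : 'I_n -> bool).
Implicit Types (L : seq (seq 'I_n)) (P : {set {set 'I_n}}).

Definition set_of_blocks L : {set {set 'I_n}} :=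
  [set A in [seq [set j in B] | B <- L]].

Definition blocks_of_set P : seq (seq 'I_n) := [seq enum (pred_of_set B) | B <-
  enum P].

Lemma canonical_uniq w L : sorted ord_lt w -> canonical_blocks w L ->
  uniq (flatten L).
Proof.
by move=> w_lt /and4P[_ _ _ /perm_uniq ->]; apply: sorted_uniq_ord.
Qed.

Lemma map_set_of_block w L : canonical_blocks w L ->
  [seq enum (pred_of_set B) | B <- [seq [set j in B] | B <- L]] = L.
Proof.
case/and4P=> _ /allP L_lt _ _; rewrite -map_comp map_id_in // => B /L_lt.
exact: enum_set_sorted.
Qed.

(** Only up to permutation, since [enum] on a set of sets need not follow the order of least
    elements. *)
Lemma perm_blocks_of_set w L : canonical_blocks w L ->
  perm_eq (blocks_of_set (set_of_blocks L)) L.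
Proof.
move=> Lw; rewrite -{2}(map_set_of_block Lw); apply: perm_map; apply: uniq_perm.
- exact: enum_uniq.
- apply: (@map_uniq _ _ (fun B : {set 'I_n} => enum (pred_of_set B))).
  rewrite (map_set_of_block Lw); case/and4P: Lw => _ _ + _.
  by move/(sorted_uniq ltn_trans ltnn)/map_uniq.
by move=> A; rewrite mem_enum inE.
Qed.

Lemma canonical_inj w L L' : canonical_blocks w L -> canonical_blocks w L' ->
  set_of_blocks L = set_of_blocks L' -> L = L'.
Proof.
move=> Lw L'w LL'.
have lt_trans : transitive (relpre (@least n) ltn) by move=> y x z;
  apply: ltn_trans.
apply: (irr_sorted_eq lt_trans).
- by move=> x; apply: ltnn.
- by rewrite -sorted_map; case/and4P: Lw.
- by rewrite -sorted_map; case/and4P: L'w.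
apply: perm_mem; rewrite -(permPl (perm_blocks_of_set Lw)) LL'.
exact: perm_blocks_of_set L'w.
Qed.

Lemma partition_set_of_blocks L : canonical_blocks (enum 'I_n) L ->
  finset.partition (set_of_blocks L) finset.setT.
Proof.
move=> Lw; have Lu := canonical_uniq (sorted_enum _) Lw.
case/and4P: Lw => /allP L0 _ _ /perm_mem Lw; apply/and3P; split.
- apply/eqP/setP => j; rewrite !inE; apply/bigcupP.
  have: j \in flatten L by rewrite Lw mem_enum.
  case/flattenP=> B BL jB; exists [set j in B]; last by rewrite inE.
  by rewrite inE map_f.
- apply/finset.trivIsetP => A A'; rewrite !inE => /mapP[B BL ->] /mapP[C CL ->].
  move=> BC; apply/pred0P => j /=; apply/negP; rewrite !inE => /andP[jB jC].
  by rewrite (uniq_flatten_inj Lu BL CL jB jC) eqxx in BC.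
rewrite inE; apply/mapP => -[B BL /setP B0].
by case: B BL B0 (L0 B BL) => // j B _ /(_ j); rewrite !inE eqxx.
Qed.

Lemma canonical_blocks_of_set P : finset.partition P finset.setT ->
  exists2 L, canonical_blocks (enum 'I_n) L & set_of_blocks L = P.
Proof.
case/and3P=> /eqP Pcover Ptriv P0.
pose le_least := fun B C : seq 'I_n => (least B <= least C)%N.
pose L := sort le_least (blocks_of_set P).
have PL : perm_eq L (blocks_of_set P) by rewrite perm_sort.
have mem_blocks B : B \in blocks_of_set P -> exists2 A, A \in P & B = enum A.
  by case/mapP=> A; rewrite mem_enum => AP ->; exists A.
have blocks0 B : B \in blocks_of_set P -> B != [::].
  case/mem_blocks=> A AP ->; apply: contraNneq P0 => A0.
  suff -> : finset.set0 = A by [].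
  by apply/setP => j; rewrite inE -mem_enum A0.
exists L; last first.
  apply/setP => A; rewrite inE (perm_mem (perm_map _ PL)) -map_comp.
  rewrite map_id_in ?mem_enum // => B _ /=.
  by apply/setP => j; rewrite inE mem_enum.
apply/and4P; split.
- by rewrite (perm_all _ PL); apply/allP => B /blocks0.
- rewrite (perm_all _ PL); apply/allP => B /mem_blocks[A _ ->].
  exact: sorted_enum.
- rewrite ltn_sorted_uniq_leq sorted_map sort_sorted ?andbT; last first.
    by move=> B C; apply: leq_total.
  rewrite (perm_uniq (perm_map _ PL)) -map_comp map_inj_in_uniq ?enum_uniq //.
  (* Blocks with equal least elements share that element, hence coincide by disjointness; this makes
     the sorted list strictly increasing. *)
  move=> A A'; rewrite !mem_enum => AP A'P /= AA'.
  have [|j jA jE] := @least_mem n (enum A); first by apply/blocks0/map_f;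
    rewrite mem_enum.
  have [|k kA kE] := @least_mem n (enum A'); first by apply/blocks0/map_f;
    rewrite mem_enum.
  have jk : j = k by apply: val_inj; rewrite /= -jE -kE.
  rewrite -jk mem_enum in kA; rewrite mem_enum in jA.
  by rewrite -(finset.def_pblock Ptriv AP jA) (finset.def_pblock Ptriv A'P kA).
rewrite (permPl (perm_eq_flatten PL)).
(* Every letter occurs, and by disjointness the total length is [n]; hence no letter occurs
   twice. *)
have sub : {subset enum 'I_n <= flatten (blocks_of_set P)}.
  move=> j _; have : j \in finset.cover P by rewrite Pcover inE.
  case/bigcupP=> A AP jA; apply/flattenP; exists (enum A); rewrite ?mem_enum //.
  by apply: map_f; rewrite mem_enum.
have szE : size (flatten (blocks_of_set P)) = size (enum 'I_n).
  rewrite size_flatten sumnE big_map big_map -cardE card_ord.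
  rewrite -[RHS](card_ord n) -cardsT -Pcover -(eqP Ptriv) big_enum.
  by apply: eq_bigr => A _; rewrite cardE.
apply: uniq_perm; rewrite ?enum_uniq //.
  by apply: leq_size_uniq sub _; rewrite ?enum_uniq // szE.
by move=> j; rewrite mem_enum [RHS]inE sub ?mem_enum.
Qed.

(** The hypothesis lets the sign of exchanging two blocks in [g] cancel the change of the Koszul
    sign, so each summand is independent of the listing and may be computed on the canonical one. *)
Lemma ptsum_enum (R : fieldType) (M : lmodType R) (g : seq (seq 'I_n) -> M) :
  (forall L L' B C, g (L ++ B :: C :: L') =
     (-1) ^+ (par e B && par e C) *: g (L ++ C :: B :: L')) ->
  ptsum e (enum 'I_n) g =
  \sum_(P : {set {set 'I_n}} | finset.partition P finset.setT)
    (-1) ^+ koszul e (flatten (blocks_of_set P)) *: g (blocks_of_set P).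
Proof.
move=> g_swap; have all_lt := sorted_enum 'I_n; rewrite ptsum_sorted //.
pose F L := (-1) ^+ koszul e (flatten L) *: g L.
have F_perm L L' : perm_eq L L' -> uniq (flatten L) -> F L = F L'.
  apply: (perm_swap_invariant (Q := fun L => uniq (flatten L))) =>
    [s t st|u v B C].
    by rewrite (perm_uniq (perm_eq_flatten st)).
  rewrite !flatten_cat /= (catA B) cat_uniq => /and3P[_ _].
  rewrite cat_uniq => /and3P[BC _ _].
  rewrite /F g_swap scalerA -signr_addb !flatten_cat /= -(crossingsC e BC).
  congr (_ ^+ nat_of_bool _ *: _).
  rewrite !koszul_cat !(crossings_catl, crossings_catr).
  move: (crossings e B C) (crossings e C B) (koszul e B) (koszul e C) =>
    [] [] [] [];
  by do 5 case: (crossings _ _ _); case: (koszul e _); case: (koszul e _).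
rewrite -[RHS]big_filter.
set Ps := (X in _ = \sum_(P <- X) _).
have Ps_perm : perm_eq [seq set_of_blocks L | L <- [seq Q.2 | Q <- partitions e
  (enum 'I_n)]] Ps.
  apply: uniq_perm; last move=> P.
  - rewrite map_inj_in_uniq ?partitions_uniq ?enum_uniq // => L L'.
    by move=> /(partitions_canonical all_lt) Lw /(partitions_canonical all_lt);
      apply: canonical_inj.
  - by rewrite filter_uniq // index_enum_uniq.
  rewrite mem_filter mem_index_enum andbT; apply/mapP/idP => [[L + ->]|].
    by move/(partitions_canonical all_lt)/partition_set_of_blocks.
  case/canonical_blocks_of_set => L Lw <-; exists L => //.
  exact: canonical_partitions.
rewrite -(perm_big _ Ps_perm) [RHS]big_map; apply: eq_big_seq => L.
move/(partitions_canonical all_lt) => Lw; apply/esym/F_perm.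
  exact: perm_blocks_of_set Lw.
rewrite (perm_uniq (perm_eq_flatten (perm_blocks_of_set Lw))).
exact: canonical_uniq Lw.
Qed.
End PartitionSums.

(** * Trees *)

Section Choices.
Variable A : eqType.
Implicit Types (ss : seq (seq A)) (ts : seq A).

Fixpoint choices ss : seq (seq A) :=
  if ss is s :: ss' then [seq t :: ts | t <- s,
    ts <- choices ss'] else [:: [::]].

Lemma mem_choices ts ss :
  (ts \in choices ss) = all2 (fun t (s : seq A) => t \in s) ts ss.
Proof.
elim: ss ts => [|s ss IH] [|t ts] //=.
  by apply/allpairsP => -[[]] /= ? ? [].
apply/allpairsP/andP => [[[t' ts'] /= [ts0 tsss [-> ->]]]|[ts0 tsss]].
  by rewrite -IH.
by exists (t, ts); rewrite IH.
Qed.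

Lemma choices_uniq ss : all uniq ss -> uniq (choices ss).
Proof.
elim: ss => //= s ss IH /andP[s_uniq /IH ss_uniq].
by apply: allpairs_uniq => // -[t ts] [t' ts'] _ _ /= [-> ->].
Qed.

Definition xor_sum (c : A -> bool) ts : bool := foldr addb false (map c ts).

(** The prefix [u] holds the arguments already expanded, which lets the induction run through the
    argument list. *)
Lemma multilinear_choices (R : fieldType) (U W : superSpace R) (m : seq U -> W)
    (c : A -> bool) (b : A -> U) u ss : multilinear m ->
  m (u ++ map (fun s => \sum_(t <- s) (-1) ^+ c t *: b t) ss) =
  \sum_(ts <- choices ss) (-1) ^+ xor_sum c ts *: m (u ++ map b ts).
Proof.
move=> m_lin; elim: ss u => [|s ss IH] u /=; first by rewrite big_seq1 scale1r.
rewrite big_allpairs_dep; elim: s => [|t s IHs].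
  by rewrite !big_nil multilinear0.
rewrite !big_cons multilinearD // IHs multilinearZ // -cat_rcons IH scaler_sumr.
congr (_ + _); apply: eq_bigr => ts _.
by rewrite scalerA -signr_addb cat_rcons.
Qed.

End Choices.

Lemma all2_mapr (S T T' : Type) (r : S -> T' -> bool) (f : T -> T') s t :
  all2 r s (map f t) = all2 (fun x y => r x (f y)) s t.
Proof. by elim: s t => [|x s IH] [|y t] //=; rewrite IH. Qed.

Lemma all2_impl (S : Type) (T : eqType) (r r' : S -> T -> bool) s t :
  (forall x y, y \in t -> r x y -> r' x y) -> all2 r s t -> all2 r' s t.
Proof.
elim: s t => [|x s IH] [|y t] //= rr' /andP[xy st].
rewrite rr' ?mem_head //=; apply: IH st => x' y' y't; apply: rr'.
by rewrite inE y't orbT.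
Qed.

Section TreeSums.
Variables (n : nat) (e : 'I_n -> bool).
Implicit Types (t : tree n) (ts : seq (tree n)) (w : seq 'I_n).

Definition node ts : tree n := GenTree.Node (size ts) ts.

(** Mirrors [transfer_rec]: a leaf for [input], a vertex for each [s] after [m]. The filter keeps
    the partitions on which [m] need not vanish, which are also the vertices allowed in a tree. *)
Fixpoint trees k w : seq (tree n) :=
  if k is k'.+1 then
    (if w is [:: j] then [:: GenTree.Leaf j] else [::]) ++
    map node [seq ts
      | P <- [seq P <- [seq Q.2 | Q <- partitions e w] | (1 < size P)%N],
        ts <- choices (map (trees k') P)]
  else [::].

Definition forests k w : seq (seq (tree n)) :=
  [seq ts | P <- [seq P <- [seq Q.2 | Q <- partitions e w] | (1 < size P)%N],
            ts <- choices (map (trees k) P)].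

Lemma treesS k w : trees k.+1 w =
  (if w is [:: j] then [:: GenTree.Leaf j] else [::]) ++ map node (forests k w).
Proof. by []. Qed.

Definition tree_on t w := well_formed t && perm_eq (leaves t) w.

Lemma all2_tree_on ts P : all2 tree_on ts P ->
  [/\ size ts = size P, all (@well_formed n) ts,
      map (@least_leaf n) ts = map (@least n) P
    & perm_eq (flatten (map (@leaves n) ts)) (flatten P)].
Proof.
elim: ts P => [|t ts IH] [|B P] //= /andP[/andP[t_wf tB] /IH[-> -> -> tsP]].
split=> //; first by rewrite t_wf.
  by congr (_ :: _); apply: eq_least; apply: perm_mem.
exact: perm_cat.
Qed.

Lemma mem_forests k w ts : sorted ord_lt w ->
  (forall B t, sorted ord_lt B -> t \in trees k B -> tree_on t B) ->
  ts \in forests k w -> exists P, [/\ canonical_blocks w P, (1 < size P)%N,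
    P \in [seq Q.2 | Q <- partitions e w] & all2 tree_on ts P].
Proof.
move=> w_lt IH /allpairsPdep[P [ts' [+ ts'P ->]]].
rewrite mem_filter => /andP[P1 Pw]; have Pcan := partitions_canonical w_lt Pw.
exists P; split=> //; move: ts'P; rewrite mem_choices all2_mapr.
apply: all2_impl => t B BP; apply: IH.
by case/and4P: Pcan => _ /allP /(_ _ BP).
Qed.

Lemma trees_tree_on k w t : sorted ord_lt w -> t \in trees k w -> tree_on t w.
Proof.
elim: k w t => // k IH w t w_lt; rewrite treesS mem_cat =>
  /orP[|/mapP[ts + ->]].
  by case: w {w_lt} => [|j [|? ?]] //; rewrite inE => /eqP ->;
    rewrite /tree_on /=.
case/(mem_forests w_lt IH) => P [/and4P[_ _ P_lt Pw] P1 _ /all2_tree_on].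
case=> tsP ts_wf ts_least ts_leaves.
rewrite /tree_on /= eqxx tsP P1 ts_wf ts_least P_lt /=.
exact: perm_trans ts_leaves Pw.
Qed.

Fixpoint leaves_nil t : well_formed t -> leaves t != [::].
Proof.
case: t => [j|k [|t ts]] //=; first by case: k => // ? /andP[].
case/and4P=> _ _ /andP[/leaves_nil + _] _.
by case: (leaves t).
Qed.

Lemma tree_on_trees k w t : sorted ord_lt w -> (size w <= k)%N ->
  tree_on t w -> t \in trees k w.
Proof.
elim: k w t => [|k IH] w t w_lt wk /andP[t_wf tw].
  by move: (leaves_nil t_wf) (perm_size tw); case: w wk {w_lt tw} => //;
    case: (leaves t).
rewrite treesS mem_cat; case: t t_wf tw => [j _ /= jw|l ts].
  have -> : w = [:: j] by apply: perm_small_eq => //; rewrite perm_sym.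
  by rewrite mem_head.
case/and4P=> /eqP-> ts1 ts_wf ts_lt tw; apply/orP; right.
have {}ts_wf : all (@well_formed n) ts by [].
(* The blocks are the leaf sets of the subtrees; listing the subtrees by least leaf is what makes
   [P] canonical. *)
apply/map_f/allpairsPdep; pose P := [seq enum (leaves t) | t <- ts].
have ts_uniq : uniq (flatten [seq leaves t | t <- ts]).
  by rewrite (perm_uniq tw) sorted_uniq_ord.
have ts_perm t : t \in ts -> perm_eq (leaves t) (enum (leaves t)).
  move=> t_ts; apply: uniq_perm => [||j]; last by rewrite mem_enum.
    elim: ts ts_uniq t_ts {ts1 ts_wf ts_lt tw P} => //= t' ts IHt.
    by rewrite cat_uniq inE => /and3P[t'_uniq _ /IHt {}IHt] /predU1P[->|/IHt].
  exact: enum_uniq.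
have tsP : all2 tree_on ts P.
  have ts_on t : t \in ts -> tree_on t (enum (leaves t)).
    by move=> t_ts; rewrite /tree_on (allP ts_wf) //= ts_perm.
  rewrite /P all2_mapr; elim: (ts) ts_on => // t ts' IHt ts_on /=.
  by rewrite ts_on ?mem_head // IHt // => t' t'ts;
    rewrite ts_on // inE t'ts orbT.
have [tsP1 _ tsP2 tsP3] := all2_tree_on tsP.
have Pw : canonical_blocks w P.
  apply/and4P; split.
  - apply/allP => _ /mapP[t t_ts ->]; have := leaves_nil (allP ts_wf _ t_ts).
    by have := perm_size (ts_perm _ t_ts); case: (enum _) => //;
      case: (leaves t).
  - by apply/allP => _ /mapP[t t_ts ->]; apply: sorted_enum.
  - by rewrite -tsP2.
  by rewrite -(permPl tsP3).
have PQ := canonical_partitions e w_lt Pw.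
exists P, ts; rewrite mem_filter -tsP1 ts1; split=> //.
rewrite mem_choices all2_mapr; apply: all2_impl tsP => t B BP tB.
apply: IH => //; first by case/and4P: Pw => _ /allP /(_ _ BP).
rewrite -ltnS (leq_trans _ wk) //; have /mapP[Q /partitions_spec Qw PE] := PQ.
by rewrite PE in BP; apply: size_block Qw BP _; rewrite -PE -tsP1.
Qed.

Lemma trees_uniq k w : sorted ord_lt w -> uniq (trees k w).
Proof.
elim: k w => // k IH w w_lt; rewrite treesS cat_uniq.
apply/and3P; split; first by case: (w) => [|? []].
  apply/hasPn => _ /mapP[ts _ ->]; case: (w) => [|? []] //.
rewrite map_inj_uniq => [|ts ts' []//].
have block_lt P B : P \in [seq Q.2 | Q <- partitions e w] -> B \in P ->
  sorted ord_lt B.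
  by case/(partitions_canonical w_lt)/and4P=> _ /allP P_lt _ _ /P_lt.
apply: allpairs_uniq_dep => [|P|].
- by rewrite filter_uniq // partitions_uniq // sorted_uniq_ord.
- rewrite mem_filter => /andP[_ Pw]; apply: choices_uniq.
  by rewrite all_map; apply/allP => B /(block_lt _ _ Pw) /IH.
(* The subtrees determine the partition through their leaves, so distinct choices yield distinct
   trees. *)
have blocksE P ts : P \in [seq Q.2 | Q <- partitions e w] ->
    ts \in choices (map (trees k) P) -> P = [seq enum (leaves t) | t <- ts].
  move/block_lt; rewrite mem_choices all2_mapr.
  elim: P ts => [|B P IHP] [|t ts] //= P_lt /andP[tB tsP].
  have B_lt : sorted ord_lt B by apply: P_lt; rewrite mem_head.
  congr (_ :: _); last by apply: IHP => // C CP; apply: P_lt;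
    rewrite inE CP orbT.
  apply: eq_sorted_ord => // [|j]; first exact: sorted_enum.
  by have /andP[_ /perm_mem <-] := trees_tree_on B_lt tB; rewrite mem_enum.
move=> [P ts] [P' ts'] /allpairsPdep[P1 [ts1 [+ tsP1 [-> ->]]]].
rewrite mem_filter => /andP[_ P1w] /allpairsPdep[P2 [ts2 [+ tsP2 [-> ->]]]].
rewrite mem_filter => /andP[_ P2w] /= ts12; rewrite ts12 in tsP1 *.
by rewrite (blocksE _ _ P1w tsP1) (blocksE _ _ P2w tsP2).
Qed.

Lemma TreeE k : (n <= k)%N -> Tree n = [set` trees k (enum 'I_n)]%classic.
Proof.
move=> nk; have all_lt := sorted_enum 'I_n.
apply/seteqP; split => t /=; last exact: trees_tree_on.
by apply: tree_on_trees; rewrite // size_enum_ord.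
Qed.

(** The number of vertices mod 2. In a branch each vertex is followed by one [- s]; at the root of
    the whole tree [p] replaces it, so there the parity gets negated. *)
Fixpoint node_parity t : bool :=
  match t with
  | GenTree.Leaf _ => false
  | GenTree.Node _ ts => ~~ foldr addb false [seq node_parity t' | t' <- ts]
  end.

(** The sorted blocks have no inner sign, and crossings between subtrees depend only on their leaf
    sets; what differs is the inner sign of each subtree. *)
Lemma koszul_leaves ts P : all2 tree_on ts P -> all (sorted ord_lt) P ->
  koszul e (flatten (map (@leaves n) ts)) =
  koszul e (flatten P) (+) xor_sum (fun t => koszul e (leaves t)) ts.
Proof.
elim: ts P => [|t ts IH] [|B P] //= /andP[/andP[t_wf tB] tsP] /andP[B_lt P_lt].
have [_ _ _ tsP'] := all2_tree_on tsP.
rewrite !koszul_cat (IH P) // (koszul_sorted e B_lt) (perm_crossings e tB tsP').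
rewrite /xor_sum /=.
case: (koszul e (leaves t)); case: (koszul e (flatten P));
  by case: (crossings _ _ _); case: (foldr _ _ _).
Qed.

Lemma xor_sumD (c c' : tree n -> bool) ts :
  xor_sum (fun t => c t (+) c' t) ts = xor_sum c ts (+) xor_sum c' ts.
Proof.
elim: ts => //= t ts IH; rewrite /xor_sum /= -!/(xor_sum _ _) IH.
by rewrite -!addbA; congr (_ (+) _); rewrite addbCA.
Qed.

Variables (R : fieldType) (V H : superSpace R) (m : seq (Pi V) -> Pi V).
Variables (i : {linear Pi H -> Pi V}) (s : {linear Pi V -> Pi V}).
Variable x : 'I_n -> Pi H.
Hypothesis m_small : forall u, (size u < 2)%N -> m u = 0.
Hypothesis m_lin : multilinear m.
Hypothesis x_homog : forall j, homog (e j) (x j).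

Let tag j := (e j, x j).
Let branch := branch_map i s m x.
Let tree_sign t := node_parity t (+) koszul e (leaves t).

(** Used twice: at inner vertices, where [- s] is applied afterwards, and at the root, where [p]
    is. *)
Lemma ptsum_forests k w (f : seq 'I_n -> Pi V) : sorted ord_lt w ->
  (forall B, sorted ord_lt B ->
    f B = \sum_(t <- trees k B) (-1) ^+ tree_sign t *: branch t) ->
  ptsum e w (fun P => m (map f P)) =
  \sum_(ts <- forests k w)
    (-1) ^+ (xor_sum node_parity ts (+) koszul e (flatten (map (@leaves n) ts)))
      *: m (map branch ts).
Proof.
move=> w_lt fE; rewrite ptsum_sorted // /forests big_allpairs_dep big_filter.
rewrite [RHS]big_mkcond; apply: eq_big_seq => P Pw.
case: ltnP => P1; last by rewrite m_small ?size_map // scaler0.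
have /and4P[_ P_lt _ _] := partitions_canonical w_lt Pw.
have -> : map f P =
    map (fun s => \sum_(t <- s) (-1) ^+ tree_sign t *: branch t) (map (trees k)
      P).
  by rewrite -map_comp; apply/eq_in_map => B /(allP P_lt) /fE.
rewrite (multilinear_choices _ _ [::]) // scaler_sumr; apply: eq_big_seq => ts.
rewrite mem_choices all2_mapr => tsP; rewrite scalerA -signr_addb.
congr (_ ^+ nat_of_bool _ *: _); rewrite (@koszul_leaves ts P) //.
  by rewrite /tree_sign xor_sumD addbCA.
by apply: all2_impl tsP => t B /(allP P_lt); apply: trees_tree_on.
Qed.

Lemma transfer_rec_trees k w : sorted ord_lt w ->
  transfer_rec m i s k (map tag w) =
  \sum_(t <- trees k w) (-1) ^+ tree_sign t *: branch t.
Proof.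
elim: k w => [|k IH] w w_lt; first by rewrite big_nil.
rewrite treesS big_cat big_map /= (ptsum_map (e := e)) //; congr (_ + _).
  case: w {w_lt} => [|j [|? ?]]; rewrite ?big_nil //= big_seq1 /=.
  by rewrite /tree_sign /= andbF scale1r (eqP (x_homog j)).
transitivity (- s (ptsum e w (fun P =>
    m (map (fun B => transfer_rec m i s k (map tag B)) P)))).
  by congr (- s _); apply: eq_ptsum => P _; rewrite -map_comp.
rewrite (ptsum_forests w_lt IH) linear_sum -sumrN; apply: eq_bigr => ts _.
rewrite linearZ -scaleNr /=; congr (_ *: _).
by rewrite /tree_sign /= addNb -/(xor_sum _ _) signrN.
Qed.

End TreeSums.

(** * From words to multilinear maps *)

Section Taggings.
Variables (R : fieldType) (K W : superSpace R).
Implicit Types (F : seq (bool * K) -> W) (u v : seq K) (w : seq (bool * K)).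

Fixpoint taggings u : seq (seq (bool * K)) :=
  if u is x :: u' then
    [seq (b, hcomp K b x) :: w | b <- [:: false; true], w <- taggings u']
  else [:: [::]].

(** Splitting each input into its even and odd parts extends a function of homogeneous letters to
    arbitrary inputs. *)
Definition forget_tags F u : W := \sum_(w <- taggings u) F w.

Definition tag_multilinear F : Prop := forall (u v : seq (bool * K)) b c x y,
  F (u ++ (b, c *: x + y) :: v) =
  c *: F (u ++ (b, x) :: v) + F (u ++ (b, y) :: v).

Lemma size_taggings u w : w \in taggings u -> size w = size u.
Proof.
elim: u w => [|x u IH] w; first by rewrite inE => /eqP->.
by case/allpairsPdep=> b [w' [_ /IH uw ->]]; rewrite /= uw.
Qed.

Lemma forget_tags_nil F : forget_tags F [::] = F [::].
Proof. exact: big_seq1. Qed.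

Lemma forget_tags_cons F x u :
  forget_tags F (x :: u) =
  forget_tags (fun w => F ((false, hcomp K false x) :: w)) u +
  forget_tags (fun w => F ((true, hcomp K true x) :: w)) u.
Proof. by rewrite /forget_tags /= cats0 big_cat !big_map. Qed.

Lemma forget_tags_cat F u v :
  forget_tags F (u ++ v) = forget_tags (fun w => forget_tags (fun w' =>
    F (w ++ w')) v) u.
Proof.
elim: u F => [|x u IH] F; first by rewrite forget_tags_nil.
by rewrite cat_cons !forget_tags_cons !IH.
Qed.

Lemma tag_multilinear0 F (u v : seq (bool * K)) b : tag_multilinear F ->
  F (u ++ (b, 0) :: v) = 0.
Proof.
move=> F_lin; have := F_lin u v b (-1) 0 0.
by rewrite scaler0 addr0 scaleN1r addNr.
Qed.

(** The tagging with the wrong parity carries the letter 0 and drops out by linearity. *)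
Lemma forget_tags_cons_homog F b x u : tag_multilinear F -> homog b x ->
  forget_tags F (x :: u) = forget_tags (fun w => F ((b, x) :: w)) u.
Proof.
move=> F_lin /eqP xb; have xNb : hcomp K (~~ b) x = 0 by rewrite -xb hcompNK.
have zero c : forget_tags (fun w => F ((c, 0) :: w)) u = 0.
  by apply: big1 => w _; apply: (tag_multilinear0 [::] _ _).
by rewrite forget_tags_cons; case: b xb xNb => /= -> ->;
  rewrite zero ?add0r ?addr0.
Qed.

Lemma tag_multilinear_cat F w : tag_multilinear F ->
  tag_multilinear (fun w' => F (w ++ w')).
Proof. by move=> F_lin u v b c x y; rewrite !catA F_lin. Qed.

Lemma forget_tags_homog F w : tag_multilinear F ->
  all (fun t => homog t.1 t.2) w -> forget_tags F (map snd w) = F w.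
Proof.
elim: w F => [|[b x] w IH] F F_lin /=; first by rewrite forget_tags_nil.
case/andP=> xb w_homog; rewrite (forget_tags_cons_homog _ F_lin xb) IH //.
exact: (tag_multilinear_cat [:: (b, x)] F_lin).
Qed.

Lemma forget_tags_multilinear F : tag_multilinear F ->
  multilinear (forget_tags F).
Proof.
move=> F_lin u v c x y; rewrite !forget_tags_cat /forget_tags scaler_sumr
  -big_split.
apply: eq_bigr => w _; rewrite -!/(forget_tags _ _) !forget_tags_cons !linearP
  /=.
rewrite scalerDr addrACA /forget_tags; congr (_ + _);
  by rewrite scaler_sumr -big_split; apply: eq_bigr => w' _; rewrite F_lin.
Qed.

Lemma forget_tags_symmetric F : tag_multilinear F ->
  (forall (u v : seq (bool * K)) x y, F (u ++ x :: y :: v) =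
     (-1) ^+ (x.1 && y.1) *: F (u ++ y :: x :: v)) ->
  graded_symmetric (forget_tags F).
Proof.
move=> F_lin F_sym u v b c x y xb yc;
  rewrite !forget_tags_cat /forget_tags scaler_sumr.
apply: eq_bigr => w _; rewrite -!/(forget_tags _ _).
have F_linw := tag_multilinear_cat w F_lin.
rewrite (forget_tags_cons_homog _ F_linw xb) (forget_tags_cons_homog _ F_linw
  yc).
rewrite (forget_tags_cons_homog _ (tag_multilinear_cat [:: (b, x)] F_linw) yc).
rewrite (forget_tags_cons_homog _ (tag_multilinear_cat [:: (c, y)] F_linw) xb).
by rewrite /forget_tags scaler_sumr; apply: eq_bigr => w' _; rewrite F_sym.
Qed.

Lemma forget_tags_parity F q : tag_multilinear F ->
  (forall w, homog (q (+) par fst w) (F w)) -> has_parity (forget_tags F) q.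
Proof.
move=> F_lin F_par e u eu; pose w := zip e u.
have [eE uE w_homog] : [/\ e = map fst w, u = map snd w & all (fun t =>
  homog t.1 t.2) w].
  rewrite {}/w; elim: e u eu => [|b e IH] [|x u] //= /andP[xb /IH[eE uE w_h]].
  by rewrite xb w_h -eE -uE.
by rewrite uE forget_tags_homog // eE count_map; apply: F_par.
Qed.

End Taggings.

Lemma strong_retract_Pi (R : fieldType) (V H : superSpace R)
    (i : {linear H -> V}) (p : {linear V -> H}) (s : {linear V -> V}) :
  strong_retract i p s -> @strong_retract R (Pi V) (Pi H) i p s.
Proof. by case=> *; split=> // b v /=. Qed.

Lemma retract_quasi_iso (R : fieldType) (U K : superSpace R)
    (i : {linear K -> U}) (p : {linear U -> K}) (s : {linear U -> U}) :
  strong_retract i p s -> quasi_iso i.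
Proof.
move=> ips; split=> [h|]; first by rewrite (retract_i_chain ips).
have i_cycle (z : cycles K) : i (cycle_val z) \in @is_cycle R U.
  by case: z => h /= /eqP dh; apply/eqP;
    rewrite -(retract_i_chain ips) dh raddf0.
have p_cycle (z : cycles U) : p (cycle_val z) \in @is_cycle R K.
  by case: z => v /= /eqP dv; apply/eqP;
    rewrite -(retract_p_chain ips) dv raddf0.
pose g (h : homology_type K) := hclass (Cycle (i_cycle (repr h))).
pose g' (h : homology_type U) := hclass (Cycle (p_cycle (repr h))).
have gE z : g (hclass z) = hclass (Cycle (i_cycle z)).
  apply/hclassP; have /hclassP/asboolP[v dv] := hclass_repr (hclass z).
  apply/asboolP; exists (i v).
  by rewrite -(retract_i_chain ips) dv /= raddfB.
have g'E z : g' (hclass z) = hclass (Cycle (p_cycle z)).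
  apply/hclassP; have /hclassP/asboolP[v dv] := hclass_repr (hclass z).
  apply/asboolP; exists (p v).
  by rewrite -(retract_p_chain ips) dv /= raddfB.
exists g; last first.
  by move=> z w wE; rewrite gE; congr hclass; apply: val_inj; rewrite /= wE.
exists g' => h; rewrite -[h]hclass_repr; move: (repr h) => {h} z.
  rewrite gE g'E; apply/hclassP/asboolP; exists 0.
  by rewrite raddf0 /= (retract_pi ips) subrr.
(* On a cycle z, [retract_ds] reads d s z = z - i p z, so - s z bounds i p z - z. *)
rewrite g'E gE; apply/hclassP/asboolP; exists (- s (cycle_val z)).
have /eqP dz : diff U (cycle_val z) == 0 by case: z.
have := retract_ds ips (cycle_val z); rewrite dz raddf0 addr0 raddfN /= => ->.
by rewrite opprB.
Qed.

Lemma Linfty_relation_shsum (R : fieldType) (V : superSpace R)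
    (m : seq (Pi V) -> Pi V) (w : seq (bool * Pi V)) :
  Linfty_algebra m -> all (fun t => homog t.1 t.2) w ->
  shsum fst w
    (fun a b => with_diff m (with_diff m (map snd a) :: map snd b)) = 0.
Proof.
(* Indexing by positions keeps equal letters of [w] apart, as a relation over subsets of inputs
   requires. *)
move=> m_alg w_homog; pose t := tnth (in_tuple w).
have -> : w = map t (enum 'I_(size w)) by rewrite map_tnth_enum.
rewrite (shsum_map (e := fst \o t)) // shsum_enum.
have t_homog j : homog (t j).1 (t j).2.
  by apply: (allP w_homog); apply: mem_tnth.
rewrite -[RHS](Linfty_relation m_alg t_homog) [RHS]big_mkcond /=.
apply: eq_bigr => A _; rewrite -!map_comp; case: ifP => // A0.
(* The relation omits the empty subset; its term has [m [::] = 0] as an argument and so vanishes. *)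
have {A0} -> : A = finset.set0 by apply/eqP;
  rewrite -cards_eq0 -leqn0 leqNgt A0.
have small := Linfty_small m_alg.
have q_lin : multilinear (with_diff m) :=
  add_diff_linear small (Linfty_multilinear m_alg).
rewrite enum_set0 /= [m [::]]small //.
by rewrite -[X in _ *: X]/(with_diff m ([::] ++ 0 :: _)) multilinear0 //
  scaler0.
Qed.

(** * The induced structure and morphism *)

Section InducedStructure.
Variables (R : fieldType) (V H : superSpace R) (m : seq (Pi V) -> Pi V).
Variables (i : {linear Pi H -> Pi V}) (p : {linear Pi V -> Pi H}).
Variable s : {linear Pi V -> Pi V}.
Hypothesis m_alg : Linfty_algebra m.
Hypothesis ips : strong_retract i p s.
Hypothesis H_diff : forall h, diff (Pi H) h = 0.

Let m_small := Linfty_small m_alg.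
Let m_lin := Linfty_multilinear m_alg.
Let m_sym := Linfty_symmetric m_alg.
Let m_odd := Linfty_odd m_alg.
Let m_rel w := @Linfty_relation_shsum R V m w m_alg.

Definition induced_l : seq (Pi H) -> Pi H := forget_tags (transfer_l m i p s).
Definition induced_f : seq (Pi H) -> Pi V := forget_tags (transfer m i s).

Let l_lin : tag_multilinear (transfer_l m i p s).
Proof. by move=> u v b c x y; apply: (transfer_l_combines i p s m_lin c b x y
  (leqnn _)). Qed.

Let f_lin : tag_multilinear (transfer m i s).
Proof. by move=> u v b c x y; apply: (transfer_combines i s m_lin c b x y (leqnn
  _)). Qed.

Lemma induced_l_small u : (size u < 2)%N -> induced_l u = 0.
Proof.
move=> u2; apply: big1_seq => w /size_taggings uw.
by rewrite transfer_l_small ?uw.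
Qed.

Lemma with_diff_l u : with_diff induced_l u = induced_l u.
Proof. by case: u => [|x [|y u]] //=; rewrite H_diff induced_l_small. Qed.

Section Inputs.
Variables (n : nat) (e : 'I_n -> bool) (x : 'I_n -> Pi H).
Hypothesis x_homog : forall j, homog (e j) (x j).

Let tag j := (e j, x j).

Let tag_homog B : all (fun t => homog t.1 t.2) (map tag B).
Proof. by apply/allP => _ /mapP[j _ ->]; apply: x_homog. Qed.

Let map_tag B : map x B = map snd (map tag B).
Proof. by rewrite -map_comp. Qed.

Lemma induced_lE B : induced_l (map x B) = transfer_l m i p s (map tag B).
Proof. by rewrite map_tag /induced_l forget_tags_homog. Qed.

Lemma induced_fE B : induced_f (map x B) = transfer m i s (map tag B).
Proof. by rewrite map_tag /induced_f forget_tags_homog. Qed.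

(** The left side has the shape common to both relations: [F] is the transferred l for the algebra
    relation and the transferred f for the morphism relation. *)
Lemma sum_tagged_l (M : superSpace R) (F : seq (bool * Pi H) -> M) :
  tag_multilinear F ->
  \sum_(A : {set 'I_n} | (0 < #|A|)%N)
    (-1) ^+ koszul e (enum A ++ enum (~: A)) *:
      forget_tags F (with_diff induced_l (map x (enum A)) :: map x (enum (~:
        A))) =
  shsum fst (map tag (enum 'I_n)) (fun a b => F (tagged_l m i p s a :: b)).
Proof.
move=> F_lin; rewrite (shsum_map (e := e)) // shsum_enum big_mkcond /=.
apply: eq_bigr => A _; rewrite with_diff_l induced_lE.
have -> : forget_tags F (transfer_l m i p s (map tag (enum A)) :: map x (enum
  (~: A))) =
    F (tagged_l m i p s (map tag (enum A)) :: map tag (enum (~: A))).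
  rewrite map_tag -(forget_tags_homog F_lin) //= tag_homog andbT.
  exact: (homog_transfer_l m_odd ips).
case: ifP => // A0.
have -> : A = finset.set0 by apply/eqP; rewrite -cards_eq0 -leqn0 leqNgt A0.
rewrite enum_set0 /= /tagged_l transfer_l_small //.
by rewrite (tag_multilinear0 [::]) ?scaler0.
Qed.

End Inputs.

Lemma induced_l_algebra : Linfty_algebra induced_l.
Proof.
split.
- exact: induced_l_small.
- exact: forget_tags_multilinear.
- apply: forget_tags_symmetric => // u v x y.
  exact: (transfer_l_swaps m_lin m_sym m_odd ips x y (leqnn _)).
- apply: forget_tags_parity => // w; rewrite addTb.
  exact: (homog_transfer_l m_odd ips).
move=> n e x x_homog.
rewrite -[RHS](transfer_l_relation m_small m_lin m_odd m_rel ips H_diff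
  (map (fun j => (e j, x j)) (enum 'I_n))).
rewrite -(sum_tagged_l x_homog l_lin); apply: eq_bigr => A _.
by rewrite with_diff_l.
Qed.

Lemma induced_f_morphism : Linfty_morphism induced_l m induced_f.
Proof.
split.
- by rewrite /induced_f forget_tags_nil.
- exact: forget_tags_multilinear.
- apply: forget_tags_symmetric => // u v x y.
  exact: (transfer_swaps m_lin m_sym m_odd ips x y (leqnn _)).
- apply: forget_tags_parity => // w; rewrite addFb.
  exact: (homog_transfer m_odd ips).
move=> n e x _ x_homog; rewrite (sum_tagged_l x_homog f_lin).
rewrite -[LHS]/(morphism_lhs m i p s _).
rewrite (morphism_sidesE m_small m_lin m_odd m_rel ips H_diff).
rewrite /morphism_rhs (ptsum_map (e := e)) // ptsum_enum.
  apply: eq_bigr => P _; congr (_ *: with_diff m _).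
  by rewrite -!map_comp; apply: eq_map => B /=; rewrite (induced_fE x_homog).
move=> L L' B C; rewrite !map_cat /=.
(* With two blocks to exchange there are at least two arguments, so the differential is absent and
   graded symmetry of [m] suffices. *)
have qE u (y z : Pi V) v :
    add_diff m (u ++ y :: z :: v) = m (u ++ y :: z :: v) by case: u => [|? []].
have tag_par D : par e D = par fst (map (fun j => (e j, x j)) D).
  by rewrite /par count_map.
by rewrite !qE !tag_par; apply: m_sym; apply: (homog_transfer m_odd ips).
Qed.

Lemma induced_f1 h : induced_f [:: h] = i h.
Proof.
rewrite /induced_f forget_tags_cons !forget_tags_nil !(transfer1 _ _ m_small).
rewrite !hcompK -linearD; congr (i _); exact: (@hcompD R (Pi H) h).
Qed.

Lemma induced_l_trees n (e : 'I_n -> bool) (x : 'I_n -> Pi H) :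
  (1 < n)%N -> (forall j, homog (e j) (x j)) ->
  induced_l (map x (enum 'I_n)) =
  \sum_(t \in Tree n)
    (-1) ^+ (~~ node_parity t (+) koszul e (leaves t)) *: tree_map i s p m x t.
Proof.
move=> n1 x_homog; have all_lt := sorted_enum 'I_n.
(* Fuel [n.+1] exposes the root and leaves fuel [n] for its branches. *)
rewrite (TreeE e (leqnSn n)) -fsbig_seq ?trees_uniq // treesS big_cat big_map
  /=.
have -> : (if enum 'I_n is [:: j] then [:: GenTree.Leaf j] else [::]) =
  [::] :> seq (tree n).
  by have := size_enum_ord n; case: (enum _) => [|j [|? ?]] //= n1E;
    rewrite -n1E in n1.
rewrite big_nil add0r (induced_lE x_homog) /transfer_l /transfer_m.
rewrite (ptsum_map (e := e)) //.
(* No block is longer than [n], so fuel [n] computes [transfer] on all of them. *)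
transitivity (p (ptsum e (enum 'I_n) (fun P =>
    m (map (fun B => transfer_rec m i s n (map (fun j => (e j, x j)) B)) P)))).
  congr (p _); apply: eq_ptsum => P /andP[_ /perm_size Pn]; congr m.
  rewrite -map_comp; apply/eq_in_map => B BP /=.
  rewrite transfer_recE // size_map.
  apply: (@leq_trans (size (flatten P))); last by rewrite Pn size_enum_ord.
  by case/path.splitPr: BP => P1 P2; rewrite flatten_cat /= !size_cat; lia.
rewrite (ptsum_forests m_small m_lin all_lt
  (fun B => @transfer_rec_trees n e R V H m i s x m_small m_lin x_homog n B)).
rewrite linear_sum; apply: eq_bigr => ts _; rewrite linearZ /= negbK.
by [].
Qed.

End InducedStructure.

Theorem theorem7p3 (R : realType) :
  exists eps : forall n : nat, tree n -> bool,
  forall (V : superSpace R) (m : seq (Pi V) -> Pi V)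
    (i : {linear homology V -> V}) (p : {linear V -> homology V})
    (s : {linear V -> V}),
  Linfty_algebra m -> strong_retract i p s ->
  exists l : seq (Pi (homology V)) -> Pi (homology V),
    [/\ Linfty_algebra l,
        forall (n : nat) (e : 'I_n -> bool) (x : 'I_n -> Pi (homology V)),
          (1 < n)%N -> (forall j, homog (e j) (x j)) ->
          l (map x (enum 'I_n)) =
          \sum_(t \in Tree n)
            (-1) ^+ (eps n t (+) koszul e (leaves t)) *:
              tree_map i s p m x t
      & exists2 f : seq (Pi (homology V)) -> Pi V,
          Linfty_quasi_iso l m f & forall h, f [:: h] = i h].
Proof.
(* A tree with at least one vertex has one internal edge fewer than vertices, so this is the parity
   of the number of internal edges. It depends on the tree alone and can be fixed before [V]. *)
exists (fun n t => ~~ node_parity t) => V m i p s m_alg ips.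
have ips' := strong_retract_Pi ips.
have H_diff h : diff (Pi (homology V)) h = 0 by [].
exists (@induced_l R V (homology V) m i p s); split.
- exact: induced_l_algebra.
- move=> n e x; exact: induced_l_trees.
exists (@induced_f R V (homology V) m i s); last exact: induced_f1.
split; first exact: induced_f_morphism.
have -> : (fun x => induced_f m i s [:: x]) = i.
  by apply/funext => h; apply: induced_f1.
exact: retract_quasi_iso ips'.
Qed.
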